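(* Let $A\in\mathbb{R}_{\max}^{d\times d}$ be irreducible. Denote by $\gamma$ the cyclicity of $\mathcal{G}(A)$ and by $\hat g$ the maximal girth of the strongly connected components of the critical graph $\mathcal{G}^c(A)$. Let $B$ be a matrix obtained from $A$ by setting some entries to $-\infty$, and suppose that $$T_1(A,B)\le \max_{l=1,\dots,m}\left(T_{cr}^{\sigma_l}(A,\mathcal{G}_l)-\sigma_l+1+\mathrm{ep}^{\sigma_l}(\mathcal{G}_l)\right)$$ for every representing subgraph $\mathcal{G}$ of $\mathcal{G}^c(A)$, where $\mathcal{G}_1,\dots,\mathcal{G}_m$ are the strongly connected components of $\mathcal{G}$ and $\sigma_l$ is the cyclicity of $\mathcal{G}_l$. Then (i) $T_1(A,B)\le \gamma\cdot \mathrm{Wi}\left(\left\lfloor \frac{d}{\gamma}\right\rfloor\right)+(d \operatorname{rem}\gamma)$; (ii) $T_1(A,B)\le \hat g\cdot\left(\left\lfloor \frac{d}{\gamma}\right\rfloor-2\right)+d$. In particular, (i) and (ii) hold for $B=B_{\mathrm{HA}}[A]$.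
   Context: Max-plus algebra: $\mathbb{R}_{\max}=\mathbb{R}\cup\{-\infty\}$ with $a\oplus b=\max(a,b)$ and $a\otimes b=a+b$, extended to matrices by $(A\oplus B)_{ij}=a_{ij}\oplus b_{ij}$ and $(AB)_{ij}=(A\otimes B)_{ij}=\bigoplus_k a_{ik}\otimes b_{kj}$. $A^t$ is the $t$-th max-plus power, $A^0=I$ (entries $0$ on the diagonal, $-\infty$ elsewhere); $\lambda^{\otimes t}=t\lambda$ for a scalar, and $\mu\otimes A$ adds $\mu$ to every entry. Graphs: $\mathcal{G}(A)$ is the weighted digraph with nodes $1,\dots,d$ and an arc $(i,j)$ of weight $a_{ij}$ whenever $a_{ij}\ne-\infty$. The length $l(W)$ of a walk $W$ is its number of arcs. A cycle is a closed walk with at least one arc and no repeated node other than its coinciding ends. $A$ is irreducible if $\mathcal{G}(A)$ is strongly connected; the $1\times1$ matrix $(-\infty)$ is excluded, so that the maximum cycle mean $\lambda(A)$ (the maximum over all cycles of weight divided by length) is finite. The critical graph $\mathcal{G}^c(A)$ consists of all nodes and arcs of cycles with mean weight $\lambda(A)$. A digraph is completely reducible if it is a disjoint union of strongly connected components (s.c.c.) with no arcs between different components; $\mathcal{G}^c(A)$ is completely reducible. The girth of a strongly connected digraph is the smallest length of a cycle in it. The cyclicity of a strongly connected digraph is the gcd of the lengths of its cycles; the cyclicity of a completely reducible digraph is the lcm of the cyclicities of its components. CSR terms: let $\sigma$ be the cyclicity of $\mathcal{G}^c(A)$ and $M=\left(((-\lambda(A))\otimes A)^{\sigma}\right)^*$,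 where $N^*=\bigoplus_{i\ge0}N^i$. Define $C,S,R$ by: $c_{ij}=m_{ij}$ if $j$ is a node of $\mathcal{G}^c(A)$ and $-\infty$ otherwise; $r_{ij}=m_{ij}$ if $i$ is a node of $\mathcal{G}^c(A)$ and $-\infty$ otherwise; $s_{ij}=a_{ij}-\lambda(A)$ if $(i,j)$ is an arc of $\mathcal{G}^c(A)$ and $-\infty$ otherwise. $T_1(A,B)$ is the smallest nonnegative integer $T$ such that $A^t=\left(\lambda(A)^{\otimes t}\otimes CS^tR\right)\oplus B^t$ for all $t\ge T$. Representing subgraph: a completely reducible subgraph $\mathcal{G}$ of $\mathcal{G}^c(A)$ (each of whose components contains at least one cycle) such that each s.c.c. of $\mathcal{G}^c(A)$ contains exactly one s.c.c. of $\mathcal{G}$. Cycle removal threshold: for a subgraph $\mathcal{G}$ of $\mathcal{G}(A)$ and a positive integer $\sigma$, $T_{cr}^{\sigma}(A,\mathcal{G})$ is the smallest nonnegative integer $T$ such that: for all nodes $i,j$ and each walk $W$ on $\mathcal{G}(A)$ from $i$ to $j$ that goes through a node of $\mathcal{G}$ and has length $\ge T$, there is a walk $V$ from $i$ to $j$ going through a node of $\mathcal{G}$, obtained from $W$ by removing cycles and possibly inserting cycles of $\mathcal{G}$, such that $l(V)\equiv l(W) \pmod\sigma$ and $l(V)\le T$. Exploration penalty: for a node $i$ of $\mathcal{G}$, $\mathrm{ep}^\sigma(i)$ is the least nonnegative integer $T$ such that for any multiple $t$ of $\sigma$ with $t\ge T$ there is a closed walk on $\mathcal{G}$ of length $t$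 starting at $i$ (the empty walk has length $0$); $\mathrm{ep}^\sigma(\mathcal{G})=\max_{i\in\mathcal{G}}\mathrm{ep}^\sigma(i)$. Hartmann–Arguelles scheme: a matrix $V\in\mathbb{R}_{\max}^{d\times d}$ is max-balanced if for every $W\subseteq\{1,\dots,d\}$, $\max_{i\in W,j\notin W}v_{ij}=\max_{i\notin W,j\in W}v_{ij}$. For irreducible $A$ there is a max-balanced matrix $V$ with entries $v_{ij}=-\delta_i+a_{ij}+\delta_j$ for some $\delta\in\mathbb{R}^d$ (a max-balancing of $A$). For $\mu\in\mathbb{R}_{\max}$ let $\mathcal{T}^{ha}(\mu)$ be the subgraph of $\mathcal{G}(A)$ induced by all arcs $(i,j)$ of $\mathcal{G}(A)$ with $v_{ij}\ge\mu$. Let $\mu^{ha}$ be the maximum of $\mu\le\lambda(A)$ such that $\mathcal{T}^{ha}(\mu)$ has an s.c.c. that does not contain any s.c.c. of $\mathcal{G}^c(A)$; if no such $\mu$ exists, $\mu^{ha}=-\infty$ and $\mathcal{T}^{ha}(\mu^{ha})=\mathcal{G}(A)$. Let $\mathcal{G}^{ha}$ be the union of the s.c.c.'s of $\mathcal{T}^{ha}(\mu^{ha})$ intersecting $\mathcal{G}^c(A)$. Then $B_{\mathrm{HA}}[A]$ has entry $-\infty$ at $(i,j)$ if $i$ or $j$ is a node of $\mathcal{G}^{ha}$, and $a_{ij}$ otherwise. $\mathrm{Wi}(n)=(n-1)^2+1$ if $n>1$ and $\mathrm{Wi}(1)=0$. $d\operatorname{rem}\gamma$ is the remainder of the Euclidean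 division of $d$ by $\gamma$. *)

(* Defs.v *)
From HB Require Import structures.
From mathcomp Require Import all_boot all_order all_algebra.
From mathcomp Require Import boolp classical_sets reals.

Set Implicit Arguments.
Unset Strict Implicit.
Unset Printing Implicit Defensive.

Import Order.TTheory GRing.Theory Num.Theory.

Local Open Scope ring_scope.

(* The max-plus semiring R ∪ {-oo}: [None] is -oo.  As a semiring, its sum is
   max, its product is the real +, its zero is -oo and its unit is the real 0,
   so that the matrix operations [+], [*m], [*:] and [^+] of the library on
   ['M[rmax R]_d] are the max-plus ones. *)
Definition rmax (R : realType) : Type := option R.

Section MaxPlus.
Variable R : realType.
Implicit Types x y z : rmax R.

Definition rmax_add x y : rmax R :=
  match x, y with
  | Some a, Some b => Some (Num.max a b)
  | None, _ => y
  | _, None => x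
  end.

Definition rmax_mul x y : rmax R :=
  match x, y with Some a, Some b => Some (a + b) | _, _ => None end.

Definition rmax_le x y : bool :=
  match x, y with
  | None, _ => true
  | Some a, Some b => a <= b
  | Some _, None => false
  end.

Fact rmax_addA : associative rmax_add.
Proof. by move=> [a|] [b|] [c|] //=; rewrite maxA. Qed.

Fact rmax_addC : commutative rmax_add.
Proof. by move=> [a|] [b|] //=; rewrite maxC. Qed.

Fact rmax_add0 : left_id None rmax_add.
Proof. by case. Qed.

Fact rmax_mulA : associative rmax_mul.
Proof. by move=> [a|] [b|] [c|] //=; rewrite addrA. Qed.

Fact rmax_mulC : commutative rmax_mul.
Proof. by move=> [a|] [b|] //=; rewrite addrC. Qed.

Fact rmax_mul1 : left_id (Some 0) rmax_mul.
Proof. by move=> [a|] //=; rewrite add0r. Qed.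

Fact rmax_mulDl : left_distributive rmax_mul rmax_add.
Proof. by move=> [a|] [b|] [c|] //=; rewrite addr_maxl. Qed.

Fact rmax_mul0 : left_zero None rmax_mul.
Proof. by []. Qed.

Fact rmax_1neq0 : (Some 0 : option R) != None.
Proof. by []. Qed.

Fact rmax_le_anti : antisymmetric rmax_le.
Proof. by move=> [a|] [b|] //= /le_anti->. Qed.

Fact rmax_le_trans : transitive rmax_le.
Proof. by move=> [b|] [a|] [c|] //=; apply: le_trans. Qed.

Fact rmax_le_total : total rmax_le.
Proof. by move=> [a|] [b|] //=; apply: le_total. Qed.

HB.instance Definition _ := Choice.copy (rmax R) (option R).
HB.instance Definition _ :=
  GRing.isNmodule.Build (rmax R) rmax_addA rmax_addC rmax_add0.
HB.instance Definition _ :=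
  GRing.Nmodule_isComNzSemiRing.Build (rmax R)
    rmax_mulA rmax_mulC rmax_mul1 rmax_mulDl rmax_mul0 rmax_1neq0.
HB.instance Definition _ :=
  Order.isOrder.Build ring_display (rmax R)
    (fun _ _ => erefl) (fun _ _ => erefl) (fun _ _ => erefl)
    rmax_le_anti rmax_le_trans rmax_le_total.

End MaxPlus.

Notation "a %:mp" := (Some a : rmax _)
  (at level 2, left associativity, format "a %:mp") : ring_scope.

(* Meaningful only on finite elements. *)
Definition rfin (R : realType) (x : rmax R) : R := odflt 0 x.

(* [x0] if [P] has no maximum. *)
Definition maximum (disp : Order.disp_t) (T : porderType disp) (x0 : T)
    (P : set T) : T :=
  xget x0 (fun x => P x /\ ubound P x).

Definition is_least (P : nat -> Prop) (n : nat) : Prop :=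
  P n /\ forall m, P m -> (n <= m)%N.

(* [0] if [P] is empty; used only for thresholds that always exist. *)
Definition least (P : nat -> Prop) : nat := xget 0%N (is_least P).

Section Digraphs.
Variable d : nat.

(* A set of nodes and a set of arcs. *)
Definition digraph : Type := ({set 'I_d} * {set 'I_d * 'I_d})%type.

Implicit Types (G H K : digraph) (c p : seq 'I_d).

Definition nodes G : {set 'I_d} := G.1.
Definition arcs G : {set 'I_d * 'I_d} := G.2.
Definition arel G : rel 'I_d := fun i j => (i, j) \in arcs G.

Definition wf_digraph G : Prop :=
  forall i j, arel G i j -> i \in nodes G /\ j \in nodes G.

Definition subgraph G H : bool :=
  (nodes G \subset nodes H) && (arcs G \subset arcs H).

Definition induced_by_arcs (E : {set 'I_d * 'I_d}) : digraph :=
  ([set e.1 | e in E] :|: [set e.2 | e in E], E).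

(* The cycle x_1 -> ... -> x_n -> x_1 is the sequence [:: x_1; ...; x_n];
   its length is [size c]. *)
Definition is_cycle G c : bool := [&& c != [::], uniq c & cycle (arel G) c].

Definition cycle_arcs c : seq ('I_d * 'I_d) := [seq (x, next c x) | x <- c].

(* A walk starting at [i] is [i :: p], where [path (arel G) i p]; its length
   is [size p] and its end is [last i p]. *)
Definition walk_arcs i p : seq ('I_d * 'I_d) := zip (i :: p) p.

Definition via G i p : bool := has (mem (nodes G)) (i :: p).

Definition strongly_connected G : Prop :=
  forall i j, i \in nodes G -> j \in nodes G -> connect (arel G) i j.

Definition component G i : digraph :=
  let C := [set j in nodes G | connect (arel G) i j && connect (arel G) j i] in
  (C, [set e in arcs G | (e.1 \in C) && (e.2 \in C)]).

Definition sccs G : {set digraph} := [set component G i | i in nodes G].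

Definition completely_reducible G : Prop :=
  forall H K, H \in sccs G -> K \in sccs G -> H != K ->
  forall i j, i \in nodes H -> j \in nodes K -> ~~ arel G i j.

Definition girth G : nat := least (fun n => exists2 c, is_cycle G c & size c = n).

(* Cyclicity of a strongly connected digraph (cycles have length at most d). *)
Definition scc_cyclicity G : nat :=
  \big[gcdn/0%N]_(n < d.+1 | `[< exists2 c, is_cycle G c & size c = n >]) n.

(* Cyclicity of a completely reducible digraph. *)
Definition cyclicity G : nat := \big[lcmn/1%N]_(H in sccs G) scc_cyclicity H.

(* Exploration penalties of a node and of a digraph. *)
Definition ep_node (s : nat) G (i : 'I_d) : nat :=
  least (fun T => forall t, (s %| t)%N -> (T <= t)%N ->
    exists p, [/\ path (arel G) i p, last i p = i & size p = t]).

Definition ep (s : nat) G : nat := (\max_(i in nodes G) ep_node s G i)%N.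

End Digraphs.

Section Matrices.
Variables (R : realType) (d : nat).
Implicit Types (A B V : 'M[rmax R]_d) (G : digraph d).

Definition graph A : digraph d :=
  ([set: 'I_d], [set e | A e.1 e.2 != 0]).

Definition mp_irreducible A : Prop :=
  [/\ (0 < d)%N, strongly_connected (graph A) & ~ (d = 1%N /\ A = 0)].

Definition cycle_weight A (c : seq 'I_d) : R :=
  \sum_(e <- cycle_arcs c) rfin (A e.1 e.2).

Definition cycle_mean A (c : seq 'I_d) : R := cycle_weight A c / (size c)%:R.

Definition mcm A : R :=
  maximum (0 : R) (fun m => exists2 c, is_cycle (graph A) c & cycle_mean A c = m).

Definition critical_cycle A (c : seq 'I_d) : Prop :=
  is_cycle (graph A) c /\ cycle_mean A c = mcm A.

Definition critical_graph A : digraph d :=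
  ([set i | `[< exists2 c, critical_cycle A c & i \in c >]],
   [set e | `[< exists2 c, critical_cycle A c & e \in cycle_arcs c >]]).

(* The infinite max-plus sum of the powers of [N], entrywise the supremum; an
   entry is junk if it is unbounded, but [csrM] only applies this to a matrix
   whose cycles have nonpositive weight. *)
Definition kleene_star (N : 'M[rmax R]_d) : 'M[rmax R]_d :=
  \matrix_(i, j) supremum (0 : rmax R) (fun x => exists k : nat, (N ^+ k) i j = x).

Definition csrM A : 'M[rmax R]_d :=
  kleene_star (((- mcm A)%:mp *: A) ^+ cyclicity (critical_graph A)).

Definition csrC A : 'M[rmax R]_d :=
  \matrix_(i, j) (if j \in nodes (critical_graph A) then csrM A i j else 0).

Definition csrR A : 'M[rmax R]_d :=
  \matrix_(i, j) (if i \in nodes (critical_graph A) then csrM A i j else 0).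

Definition csrS A : 'M[rmax R]_d :=
  \matrix_(i, j) (if arel (critical_graph A) i j
                  then (- mcm A)%:mp * A i j else 0).

(* [T] is T_1(A, B); for some [B] no such [T] exists. *)
Definition is_T1 A B (T : nat) : Prop :=
  is_least (fun T => forall t, (T <= t)%N ->
    A ^+ t = (mcm A)%:mp ^+ t *: (csrC A *m csrS A ^+ t *m csrR A) + B ^+ t) T.

(* [B] is obtained from [A] by setting some entries to -oo. *)
Definition subordinate B A : Prop := forall i j, B i j = A i j \/ B i j = 0.

Definition representing A G : Prop :=
  [/\ wf_digraph G, subgraph G (critical_graph A), completely_reducible G,
      forall H, H \in sccs G -> exists c, is_cycle H c &
      forall K, K \in sccs (critical_graph A) ->
        #|[set H in sccs G | subgraph H K]| = 1%N].

(* The walk [j :: q] is obtained from [i :: p] by removing cycles and inserting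
   cycles of [G]; walks are seen here as multisets of arcs, and only the arcs
   left by the removals are required to be common to both. *)
Definition cycle_exchange A G (i : 'I_d) (p : seq 'I_d) (j : 'I_d)
    (q : seq 'I_d) : Prop :=
  exists (rest : seq ('I_d * 'I_d)) (removed inserted : seq (seq 'I_d)),
    [/\ all (is_cycle (graph A)) removed, all (is_cycle G) inserted,
        perm_eq (walk_arcs i p) (rest ++ flatten (map (@cycle_arcs d) removed)) &
        perm_eq (walk_arcs j q) (rest ++ flatten (map (@cycle_arcs d) inserted))].

Definition Tcr (s : nat) A G : nat :=
  least (fun T => forall (i : 'I_d) (p : seq 'I_d),
    path (arel (graph A)) i p -> via G i p -> (T <= size p)%N ->
    exists q : seq 'I_d,
      [/\ path (arel (graph A)) i q /\ last i q = last i p,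
          via G i q, cycle_exchange A G i p i q,
          size q = size p %[mod s] & (size q <= T)%N]).

(* The right-hand side of the hypothesis for the representing subgraph [G].
   The truncated subtraction is exact: a walk of length [s - 1] on the
   component [H] shows that [s <= Tcr s A H + 1]. *)
Definition csr_bound A G : nat :=
  (\max_(H in sccs G)
     let s := scc_cyclicity H in Tcr s A H + 1 - s + ep s H)%N.

Definition max_girth_critical A : nat :=
  (\max_(H in sccs (critical_graph A)) girth H)%N.

Definition max_balanced V : Prop :=
  forall W : {set 'I_d},
    \sum_(i in W) \sum_(j in ~: W) V i j = \sum_(i in ~: W) \sum_(j in W) V i j.

Definition diag_scaling (delta : 'I_d -> R) A : 'M[rmax R]_d :=
  \matrix_(i, j) ((- delta i)%:mp * A i j * (delta j)%:mp).

(* [V] is a max-balancing of [A]. *)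
Definition max_balancing A V : Prop :=
  (exists delta : 'I_d -> R, V = diag_scaling delta A) /\ max_balanced V.

Definition Tha A V (mu : rmax R) : digraph d :=
  induced_by_arcs [set e in arcs (graph A) | mu <= V e.1 e.2].

Definition mu_ha A V : rmax R :=
  maximum (0 : rmax R) (fun mu => mu <= (mcm A)%:mp /\
    exists2 H, H \in sccs (Tha A V mu) &
      forall K, K \in sccs (critical_graph A) -> ~~ subgraph K H).

Definition Gha_nodes A V : {set 'I_d} :=
  \bigcup_(H in sccs (Tha A V (mu_ha A V)) |
           ~~ [disjoint nodes H & nodes (critical_graph A)]) nodes H.

Definition B_HA A V : 'M[rmax R]_d :=
  \matrix_(i, j) (if (i \in Gha_nodes A V) || (j \in Gha_nodes A V)
                  then 0 else A i j).

End Matrices.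

Definition Wi (n : nat) : nat := if (1 < n)%N then ((n - 1) ^ 2 + 1)%N else 0%N.

(* Main.v *)
Require Import Defs.
From HB Require Import structures.
From mathcomp Require Import all_boot all_order all_algebra.
From mathcomp Require Import boolp classical_sets reals.
From mathcomp Require Import zify ring lra.

(* Represent each component of the critical graph by a shortest cycle z, of
   length g. Its exploration penalty is 0, so everything rests on bounding the
   threshold T_cr of z. Let gamma be the cyclicity of the graph, d = gamma D + r
   and g = gamma k. The times at which a walk visits a given node agree modulo
   gamma, hence take at most k values modulo g. In a shortest walk obtained by
   removing cycles of total length divisible by g, and among those one reaching
   z as early as possible, a node therefore occurs at most k times if it lies
   on z and k + 1 times otherwise, since loops met before z can be moved after
   it. Counting the visits to a small cyclicity class, which contains at least
   k nodes of z, gives T_cr <= g (D - 1) + d - 1, which is (ii), and (i) if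
   k < D. If k = D, some small class lies entirely on z; cutting the walk at its
   nodes and keeping a zero-sum-free family of the resulting loops modulo D,
   spliced together along z or along a loop with D - 1 visits, gives
   T_cr <= gamma (D^2 - D + 2) + r - 1, which is (i).

   For the Hartmann-Arguelles matrix, in the max-balanced scaling the arcs weigh
   at most lambda, and exactly lambda when critical. A walk through the nodes
   removed from B has a node joined to some z by arcs at least as heavy as all
   its own: either its heaviest arc exceeds mu^ha, or all its arcs are at most
   mu^ha. Inserting the detour through z and reducing the walk with T_cr trades
   arcs for heavier ones, so that the walk is dominated by a CSR term. *)

Set Implicit Arguments.
Unset Strict Implicit.
Unset Printing Implicit Defensive.

Import Order.TTheory GRing.Theory Num.Theory.

Local Open Scope ring_scope.

(** * Walks and their loops *)

Section Walks.
Variable d : nat.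
Implicit Types (e : rel 'I_d) (u v i j : 'I_d) (p q : seq 'I_d) (a : pred 'I_d).

Lemma walk_arcs_cons i x p : walk_arcs i (x :: p) = (i, x) :: walk_arcs x p.
Proof. by []. Qed.

Lemma walk_arcs_cat i p q :
  walk_arcs i (p ++ q) = walk_arcs i p ++ walk_arcs (last i p) q.
Proof.
by elim: p i => [|x p IHp] i //; rewrite cat_cons !walk_arcs_cons IHp.
Qed.

Lemma size_walk_arcs i p : size (walk_arcs i p) = size p.
Proof. by rewrite size_zip /= (minn_idPr _). Qed.

Lemma walk_arcs_snd i p : unzip2 (walk_arcs i p) = p.
Proof. by rewrite unzip2_zip //=. Qed.

Lemma path_walk_arcs e i p :
  path e i p = all (fun x => e x.1 x.2) (walk_arcs i p).
Proof. by elim: p i => [|x p IHp] i //; rewrite walk_arcs_cons /= IHp. Qed.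

Lemma mem_walk_arcs i p x y : (x, y) \in walk_arcs i p -> (x \in i :: p) && (y \in p).
Proof.
elim: p i => [|z p IHp] i //; rewrite walk_arcs_cons !inE => /orP[/eqP[-> ->]|].
  by rewrite !eqxx.
by move/IHp; rewrite !inE => /andP[/orP[]-> ->]; rewrite ?orbT.
Qed.

Lemma nth_last_take i p s : (s <= size p)%N -> nth i (i :: p) s = last i (take s p).
Proof.
elim: p i s => [|x p IHp] i [|s] //= ssz.
by rewrite -IHp //=; case: s ssz => //= s ssz; apply: set_nth_default.
Qed.

Definition closed_walk e v q := path e v q && (last v q == v).

Lemma closed_walk_cat e v p q :
  closed_walk e v p -> closed_walk e v q -> closed_walk e v (p ++ q).
Proof.
move=> /andP[p1 /eqP p2] /andP[q1 q2].
by rewrite /closed_walk cat_path last_cat p2 p1 q1.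
Qed.

Lemma closed_walk_iter e v q n :
  closed_walk e v q -> closed_walk e v (flatten (nseq n q)).
Proof.
move=> qP; elim: n => [|n IHn] /=; first by rewrite /closed_walk /= eqxx.
exact: closed_walk_cat.
Qed.

Lemma size_flatten_nseq (T : Type) n (q : seq T) :
  size (flatten (nseq n q)) = (n * size q)%N.
Proof. by elim: n => //= n IHn; rewrite size_cat IHn mulSn. Qed.

(** The loop starts as late as possible: when the rest of the walk repeats no node of [a], it is [i]
    that comes back, and the loop up to its return is itself repetition-free on [a]. *)
Lemma find_loop a i p : ~~ uniq (filter a (i :: p)) ->
  exists p1 p2 p3, [/\ p = p1 ++ p2 ++ p3, last i (p1 ++ p2) = last i p1,
    a (last i p1), p2 != [::] & uniq (filter a p2)].
Proof.
elim: p i => [|x p IHp] i; first by rewrite /=; case: (a i).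
have [xp_uniq|/IHp[p1 [p2 [p3 [-> h1 h2 h3 h4]]]] _] :=
  boolP (uniq (filter a (x :: p))); last first.
  by exists (x :: p1), p2, p3; split.
rewrite [filter a (i :: _)]/=; case ai: (a i); last by rewrite xp_uniq.
rewrite [uniq (_ :: _)]/= -/(filter a (x :: p)) xp_uniq andbT negbK mem_filter ai.
move=> /splitPr; move: (x :: p) xp_uniq => s + sP; case: sP => s1 s2 uP.
exists [::], (rcons s1 i), s2; split=> //=.
- by rewrite cat_rcons.
- by rewrite last_rcons.
- by case: (s1).
- by move: uP; rewrite -cat_rcons filter_cat cat_uniq => /andP[].
Qed.

(** Loops are removed one at a time. With [a = predT] this is the decomposition of a walk into a
    path and cycles; with [a] a cyclicity class, the walk is cut only at nodes of that class. *)
Lemma loop_erasure e a i p : path e i p ->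
  exists q (cs : seq ('I_d * seq 'I_d)),
  [/\ path e i q, last i q = last i p, uniq (filter a (i :: q)),
      has a (i :: p) -> has a (i :: q) &
      (forall c, c \in cs ->
         [&& closed_walk e c.1 c.2, a c.1, c.2 != [::] & uniq (filter a c.2)]) /\
      perm_eq (walk_arcs i p)
        (walk_arcs i q ++ flatten [seq walk_arcs c.1 c.2 | c <- cs])].
Proof.
have [n] := ubnP (size p); elim: n p => // n IHn p /ltnSE pn pP.
have [pu|/find_loop[p1 [p2 [p3 [pE h1 h2 h3 h4]]]]] :=
  boolP (uniq (filter a (i :: p))).
  by exists p, [::]; split=> //; rewrite cats0.
rewrite last_cat in h1; have := pP; rewrite pE !cat_path => /and3P[P1 P2 P3].
rewrite h1 in P3.
have [||q [cs [q1 q2 q3 q4 [q5 q6]]]] := IHn (p1 ++ p3).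
- rewrite (leq_trans _ pn) // pE !size_cat; case: (p2) h3 => //= *; lia.
- by rewrite cat_path P1.
exists q, ((last i p1, p2) :: cs); split=> //.
- by rewrite q2 !last_cat h1.
- move=> _; apply: q4; apply/hasP; exists (last i p1) => //.
  by rewrite -cat_cons mem_cat mem_last.
- split=> [c|]; first by rewrite inE => /orP[/eqP-> /=|/q5//];
    rewrite /closed_walk P2 h1 eqxx h2 h3 h4.
  have /permP E := q6; apply/permP => b.
  rewrite /= !walk_arcs_cat !count_cat h1.
  have := E b; rewrite walk_arcs_cat !count_cat => {}E.
  by rewrite addnCA [RHS]addnCA; congr addn.
Qed.

Lemma cycle_arcs_zip q : uniq q -> cycle_arcs q = zip q (rot 1 q).
Proof.
case: q => [//|x s] us; rewrite /cycle_arcs rot1_cons.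
apply: (@eq_from_nth _ (x, x));
  first by rewrite size_map size_zip size_rcons /= minnn.
move=> k; rewrite size_map => ks.
rewrite (nth_map x) // nth_zip ?size_rcons //; congr (_, _).
rewrite next_nth mem_nth // index_uniq //.
by rewrite nth_rcons; case: ltnP => // h; rewrite nth_default // if_same.
Qed.

Lemma closed_cycle_arcs v q : uniq q -> last v q = v ->
  perm_eq (walk_arcs v q) (cycle_arcs q).
Proof.
case: q => [//|x s] us lv; rewrite cycle_arcs_zip //.
rewrite -(perm_rot 1) /=.
have -> : walk_arcs v (x :: s) = zip (belast v (x :: s)) (x :: s).
  rewrite /walk_arcs -{1}[v :: x :: s]/(v :: (x :: s)) lastI -cats1 -[in X in zip _ X](cats0 (x :: s)).
  by rewrite zip_cat ?size_belast //= cats0.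
rewrite /= !rot1_cons.
suff -> : rcons (zip (belast x s) s) (v, x) = zip (x :: s) (rcons s x) by [].
by rewrite (lastI x s) zip_rcons ?size_belast //; congr (rcons _ (_, _)); rewrite -lv.
Qed.

Lemma closed_walk_cycles e v q : closed_walk e v q ->
  exists2 cs : seq (seq 'I_d), (forall c, c \in cs ->
    [&& c != [::], uniq c & cycle e c])
    & perm_eq (walk_arcs v q) (flatten (map (@cycle_arcs d) cs)).
Proof.
move=> /andP[qP /eqP ql].
have [r [cs [r1 r2 r3 _ [csP E]]]] := loop_erasure predT qP.
exists [seq c.2 | c <- cs].
  move=> _ /mapP[c /csP /and4P[/andP[c1 /eqP c2] _ c3 c4] ->].
  by rewrite c3 (cycle_path c.1) -{1}(filter_predT c.2) c4;
    case: (c.2) c1 c2 c3 => //= x s + -> .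
(* The walk left by the erasure is closed and repeats no node, hence is empty. *)
case: r r1 r2 r3 E => [|x r] _; rewrite ql; last first.
  by rewrite filter_predT /= => <-; rewrite mem_last.
move=> _ _ /perm_trans; apply; rewrite -map_comp /=.
elim: cs csP => //= c cs IHcs csP; apply: perm_cat; last first.
  by apply: IHcs => x xs; apply: csP; rewrite inE xs orbT.
have /and3P[/andP[_ /eqP c2] _ c4] := csP c (mem_head _ _).
by apply: closed_cycle_arcs => //; rewrite -(filter_predT c.2).
Qed.

Lemma splice e i p v q u : path e i p -> closed_walk e v q ->
    u \in i :: p -> u \in v :: q ->
  exists r, [/\ path e i r, last i r = last i p &
    perm_eq (walk_arcs i r) (walk_arcs i p ++ walk_arcs v q)].
Proof.
move=> pP /andP[qP /eqP ql] up uq.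
have : u \in i :: p by []. move=> /(nthP i)[s]; rewrite ltnS => ss;
  rewrite nth_last_take // => lu.
have /(nthP v)[t]: u \in v :: q by []. rewrite ltnS => ts;
  rewrite nth_last_take // => lv.
move: pP qP ql; rewrite -(cat_take_drop s p) -(cat_take_drop t q).
set p1 := take s p in lu *; set p2 := drop s p; set q1 := take t q in lv *;
  set q2 := drop t q.
rewrite !cat_path !last_cat lu lv => /andP[P1 P2] /andP[Q1 Q2] ql.
(* The loop is rotated to start at [u] and inserted at a visit of [u]. *)
exists (p1 ++ (q2 ++ q1) ++ p2); split.
- by rewrite !cat_path !last_cat lu ql lv P1 Q1 Q2 P2.
- by rewrite !last_cat lu ql lv.
- apply/permP => b; rewrite !walk_arcs_cat !last_cat lu ql lv !count_cat; lia.
Qed.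

Lemma perm_walk_path e i p (s : seq ('I_d * 'I_d)) : perm_eq (walk_arcs i p) s ->
  path e i p = all (fun x => e x.1 x.2) s.
Proof. by move=> E; rewrite path_walk_arcs (perm_all _ E). Qed.

Lemma perm_walk_count a i p (s : seq ('I_d * 'I_d)) : perm_eq (walk_arcs i p) s ->
  count a p = count a (unzip2 s).
Proof. by move=> /(perm_map snd); rewrite -/unzip2 walk_arcs_snd => /permP. Qed.

Lemma perm_walk_size i p (s : seq ('I_d * 'I_d)) : perm_eq (walk_arcs i p) s ->
  size p = size s.
Proof. by move=> /perm_size; rewrite size_walk_arcs. Qed.

End Walks.

(** * Zero-sum-free sequences, cyclicity classes *)

(** Nonempty subfamilies of sum divisible by [m] are moved to [D] as long as one exists. *)
Lemma zero_sum_split (T : eqType) (m : nat) (f : T -> nat) (s : seq T) :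
  exists S D, [/\ perm_eq s (S ++ D), (m %| \sum_(x <- D) f x)%N &
    forall S1 S2, perm_eq S (S1 ++ S2) -> (m %| \sum_(x <- S1) f x)%N -> S1 = [::]].
Proof.
have [n] := ubnP (size s); elim: n s => // n IHn s /ltnSE sn.
have [[S1 [S2 [E dv S1n]]]|H] := pselect (exists S1 S2, [/\ perm_eq s (S1 ++ S2),
    (m %| \sum_(x <- S1) f x)%N & S1 != [::]]); last first.
  exists s, [::]; split; first by rewrite cats0.
    by rewrite big_nil dvdn0.
  move=> S1 S2 E dv; apply/eqP/negPn/negP => S1n; apply: H.
  by exists S1, S2; split.
have [|S [D [E' dv' free]]] := IHn S2.
  rewrite (leq_trans _ sn) // (perm_size E) size_cat -subn_gt0 addnK.
  by case: (S1) S1n.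
exists S, (S1 ++ D); split=> //; last by rewrite big_cat /= dvdn_addr.
rewrite (perm_trans E) // perm_sym perm_catCA perm_cat2l perm_sym //.
Qed.

(** With [m] terms or more, two of the prefix sums agree modulo [m], and the block between them has
    sum divisible by [m]. *)
Lemma zero_sum_free_size (T : eqType) (m : nat) (f : T -> nat) (S : seq T) :
    (0 < m)%N ->
    (forall S1 S2, perm_eq S (S1 ++ S2) -> (m %| \sum_(x <- S1) f x)%N ->
      S1 = [::]) ->
  (size S < m)%N.
Proof.
move=> m0 free; rewrite ltnNge; apply/negP => mS.
pose F (k : 'I_(size S).+1) : 'I_m :=
  Ordinal (ltn_pmod (\sum_(x <- take k S) f x)%N m0).
have /injectivePn[j0 [k0 jk0 E0]] : ~~ injectiveb F.
  by apply/negP => /injectiveP /leq_card; rewrite !card_ord ltnNge mS.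
wlog jk : j0 k0 jk0 E0 / (j0 < k0)%N.
  move=> W; have := jk0; rewrite -val_eqE neq_ltn => /orP[|] h;
    first exact: (W j0 k0).
  by apply: (W k0 j0) => //; rewrite eq_sym.
move: E0 => /(congr1 val) /= E0.
have tkE : take k0 S = take j0 S ++ drop j0 (take k0 S).
  by rewrite -{1}(cat_take_drop j0 (take k0 S)) take_takel // ltnW.
have : drop j0 (take k0 S) = [::].
  apply: (free _ (take j0 S ++ drop k0 S)).
    by rewrite perm_sym perm_catCA catA -tkE cat_take_drop.
  move: E0; rewrite {1}tkE big_cat /= -[in LHS](addn0 (\sum_(x <- take j0 S) f x)%N).
  by move/eqP; rewrite eqn_modDl mod0n eq_sym.
move=> /(congr1 size) /eqP; rewrite size_drop size_takel -1?ltnS //.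
by rewrite subn_eq0 leqNgt jk.
Qed.

Section Potentials.
Variables (d m : nat).
Implicit Types (f : 'I_d -> nat) (e : rel 'I_d) (i : 'I_d) (p : seq 'I_d).

(** Read modulo [m], such an [f] gives the cyclicity class of a node. *)
Definition potential f e := forall x y, e x y -> f y = (f x).+1 %[mod m].

Lemma potential_last f e i p : potential f e -> path e i p ->
  f (last i p) = f i + size p %[mod m].
Proof.
move=> fP; elim: p i => [|x p IHp] i /=; first by rewrite addn0.
by move=> /andP[/fP ix /IHp ->]; rewrite -modnDml ix modnDml addSnnS.
Qed.

Lemma potential_closed f e i p : potential f e -> closed_walk e i p ->
  (m %| size p)%N.
Proof.
move=> fP /andP[/(potential_last fP) + /eqP lp]; rewrite lp => /eqP.
by rewrite -{1}[f i]addn0 eqn_modDl mod0n eq_sym.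
Qed.

Definition in_class f c : pred 'I_d := fun x => f x == c %[mod m].

Lemma count_class f e i p c : potential f e -> (0 < m)%N -> path e i p ->
  f i = c %[mod m] ->
  count (in_class f c) p = (size p %/ m)%N.
Proof.
move=> fP m0 + fi; elim/last_ind: p => [|p x IHp]; first by rewrite div0n.
move=> pP; have := potential_last fP pP.
rewrite last_rcons size_rcons -cats1 count_cat divnS //= addn0 => fx.
move: pP; rewrite rcons_path => /andP[/IHp -> _]. rewrite addnC;
  congr (nat_of_bool _ + _)%N.
by rewrite /in_class fx -fi -{2}[f i]addn0 eqn_modDl mod0n.
Qed.

(** From time [s] on, the walk is in the class [c] at one time out of [m], starting with [s]
    itself. *)
Lemma class_visits f e i p s c : potential f e -> (0 < m)%N -> path e i p ->
  f i + s = c %[mod m] -> (size p < s + m * count (in_class f c) (i :: p))%N.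
Proof.
move=> fP m0 pP fc; case: (ltnP (size p) s) => ps; first by rewrite ltn_addr.
rewrite -(cat_take_drop s (i :: p)) count_cat (drop_nth i) ?ltnS // nth_last_take //=.
move: pP; rewrite -{1}(cat_take_drop s p) cat_path => /andP[P1 P2].
have lc : f (last i (take s p)) = c %[mod m].
  by rewrite (potential_last fP P1) size_takel.
rewrite (count_class fP m0 P2 lc) size_drop.
have -> : in_class f c (last i (take s p)) by apply/eqP.
have := ltn_ceil (size p - s) m0; nia.
Qed.

Lemma class_card_sum f i : (0 < m)%N ->
  (\sum_(s < m) #|in_class f (f i + s)| = d)%N.
Proof.
move=> m0.
pose S x := Ordinal (ltn_pmod (f x + (m - f i %% m))%N m0).
rewrite -[RHS]card_ord -sum1_card (partition_big S predT) //=.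
apply: eq_bigr => s _; rewrite -sum1_card; apply: eq_bigl => x /=.
rewrite -val_eqE /= /in_class unfold_in.
rewrite -[X in _ = (_ == X)](modn_small (ltn_ord s)) -[in RHS](eqn_modDr (f i %% m)).
rewrite -addnA subnK ?modnDr ?(ltnW (ltn_pmod _ m0)) //.
by rewrite modnDmr [(s + _)%N]addnC.
Qed.

(** If no offset qualified, the classes with [s <= d %% m] would have more than [d %/ m] nodes and
    the others at least [d %/ m], more than [d] in all. A late class is accepted only with one node
    less, which pays for the time needed to reach it. *)
Lemma small_class f i : (0 < m)%N ->
  exists2 s, (s < m)%N & ((s <= d %% m)%N && (#|in_class f (f i + s)| <= d %/ m)%N)
    || (#|in_class f (f i + s)| < d %/ m)%N.
Proof.
move=> m0; have [/existsP[s sP]|/existsPn H] := boolP [exists s : 'I_m,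
    ((s <= d %% m)%N && (#|in_class f (f i + s)| <= d %/ m)%N)
    || (#|in_class f (f i + s)| < d %/ m)%N]; first by exists s.
have : (\sum_(s < m) (d %/ m + (s < (d %% m).+1)) <= d)%N.
  rewrite -{3}(class_card_sum f i m0); apply: leq_sum => s _.
  by have := H s; rewrite ltnS; case: leqP => /=; lia.
rewrite big_split /= sum_nat_const card_ord.
have -> : (\sum_(s < m) (s < (d %% m).+1) = (d %% m).+1)%N.
  rewrite -big_mkcond /= sum1_card.
  have h := ltn_pmod d m0.
  rewrite -[RHS](card_ord (d %% m).+1) -(card_image (f := widen_ord h)); last first.
    by move=> x y /(congr1 val) /= /val_inj.
  apply: eq_card => x; apply/idP/mapP => [|[y _ ->]].
    by rewrite unfold_in => hx; exists (Ordinal hx); rewrite ?mem_enum //;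
      apply: val_inj.
  by rewrite unfold_in; exact: (ltn_ord y).
rewrite mulnC addnS -divn_eq ltnn //.
Qed.

End Potentials.

Section Cyclicity.
Variable d : nat.
Implicit Types (G : digraph d) (c p : seq 'I_d).

Lemma size_cycle G c : is_cycle G c -> (size c < d.+1)%N.
Proof. by case/and3P => _ /card_uniqP <- _;
  rewrite ltnS -[leqRHS]card_ord max_card. Qed.

Lemma scc_cyclicity_dvd G c : is_cycle G c -> (scc_cyclicity G %| size c)%N.
Proof.
move=> cP; apply: (@biggcdn_inf _ (Ordinal (size_cycle cP))) => //.
by apply/asboolP; exists c.
Qed.

Lemma dvd_scc_cyclicity G m :
  (forall c, is_cycle G c -> (m %| size c)%N) -> (m %| scc_cyclicity G)%N.
Proof. by move=> H; apply/dvdn_biggcdP => k /asboolP[c /H + <-]. Qed.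

Lemma size_flatten_cycle_arcs (cs : seq (seq 'I_d)) :
  size (flatten (map (@cycle_arcs d) cs)) = sumn (map size cs).
Proof.
by rewrite size_flatten /shape -map_comp; congr sumn; apply: eq_map => c /=;
  rewrite size_map.
Qed.

Lemma closed_walk_dvd G i p : closed_walk (arel G) i p ->
  (scc_cyclicity G %| size p)%N.
Proof.
move=> /closed_walk_cycles[cs csP /perm_walk_size ->];
  rewrite size_flatten_cycle_arcs.
elim: cs csP => [|c cs IHcs] csP; first by rewrite dvdn0.
rewrite dvdn_add //; first exact/scc_cyclicity_dvd/csP/mem_head.
by apply: IHcs => x xs; apply: csP; rewrite inE xs orbT.
Qed.

Lemma potential_exists G (i0 : 'I_d) : (forall i j, connect (arel G) i j) ->
  exists f, potential (scc_cyclicity G) f (arel G).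
Proof.
move=> conn; have /choice[w wP] : forall v, exists p, path (arel G) i0 p /\ last i0 p = v.
  by move=> v; have /connectP[p] := conn i0 v; exists p.
exists (fun v => size (w v)) => x y xy.
have [[wx lx] [wy ly]] := (wP x, wP y).
(* The chosen walk to [y], and the one through [x], are closed up by the same return [q]; both
   closed walks have length divisible by the cyclicity. *)
have /connectP[q qP lq] := conn y i0.
apply/eqP; rewrite -(eqn_modDr (size q)); apply/eqP.
transitivity (0 %% scc_cyclicity G)%N; rewrite mod0n; [|apply/esym]; apply/eqP;
  rewrite -/(dvdn _ _).
- rewrite -size_cat; apply: (@closed_walk_dvd _ i0).
  by rewrite /closed_walk cat_path last_cat ly wy qP -lq eqxx.
- rewrite addSnnS -[(size q).+1]/(size (y :: q)) -size_cat;
    apply: (@closed_walk_dvd _ i0).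
  by rewrite /closed_walk cat_path last_cat lx wx /= xy qP -lq eqxx.
Qed.

End Cyclicity.

(** * Pruning of walks *)

Lemma count_sum_mem (T : finType) (a : pred T) (s : seq T) :
  count a s = (\sum_(v | a v) count_mem v s)%N.
Proof.
elim: s => [|x s IHs]; first by rewrite big1.
rewrite /= IHs big_split /=; congr addn.
case ax: (a x); last first.
  by rewrite big1 // => v av; case: eqP => // xv; rewrite xv av in ax.
rewrite (bigD1 x) //= eqxx big1 // => v /andP[_ vx].
by rewrite eq_sym (negbTE vx).
Qed.

Lemma count_card_nth (T : eqType) (a : pred T) (x0 : T) (s : seq T) :
  count a s = #|[set k : 'I_(size s) | a (nth x0 s k)]|.
Proof.
rewrite -sum1_count (big_nth x0) big_mkord sum1_card.
by apply: eq_card => k; rewrite !inE.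
Qed.

Section Reduction.
Variables (R : realType) (d : nat) (A : 'M[rmax R]_d).
Let e := arel (graph A).

(* Only multisets of arcs are compared: the remaining arcs may be traversed in
   another order. *)
Definition pruned g i p q :=
  [/\ path e i q, last i q = last i p, size q = size p %[mod g] &
      exists2 cs, all (is_cycle (graph A)) cs &
        perm_eq (walk_arcs i p) (walk_arcs i q ++ flatten (map (@cycle_arcs d) cs))].

Lemma pruned_refl g i p : path e i p -> pruned g i p p.
Proof. by move=> pP; split=> //; exists [::] => //=; rewrite cats0. Qed.

Lemma pruned_perm g i p q r : pruned g i p q -> path e i r -> last i r = last i q ->
  perm_eq (walk_arcs i q) (walk_arcs i r) -> pruned g i p r.
Proof.
move=> [q1 q2 q3 [cs csP E]] rP rl qr; split=> //; first by rewrite rl.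
  by have := perm_walk_size qr; rewrite size_walk_arcs => <-.
by exists cs => //; rewrite (perm_trans E) // perm_cat2r.
Qed.

Lemma pruned_cut g i p u1 u2 u3 : pruned g i p (u1 ++ u2 ++ u3) ->
  last (last i u1) u2 = last i u1 -> (g %| size u2)%N -> pruned g i p (u1 ++ u3).
Proof.
move=> [q1 q2 q3 [cs csP E]] h gu.
move: q1; rewrite !cat_path h => /and3P[P1 P2 P3].
split; first by rewrite cat_path P1.
- by rewrite -q2 !last_cat h.
- by rewrite -q3 !size_cat addnCA -[in RHS]modnDml (eqP gu).
have [ds dsP E'] : exists2 ds : seq (seq 'I_d), (forall c, c \in ds ->
    [&& c != [::], uniq c & cycle e c]) &
    perm_eq (walk_arcs (last i u1) u2) (flatten (map (@cycle_arcs d) ds)).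
  by apply: closed_walk_cycles; rewrite /closed_walk P2 h eqxx.
exists (ds ++ cs); first by rewrite all_cat csP andbT; apply/allP.
rewrite (perm_trans E) // map_cat flatten_cat !walk_arcs_cat h -!catA perm_cat2l.
by rewrite perm_catCA perm_cat2l perm_cat2r.
Qed.

Lemma pruned_size g i p q : pruned g i p q -> (size q <= size p)%N.
Proof.
by move=> [_ _ _ [cs _ /perm_walk_size ->]]; rewrite size_cat size_walk_arcs leq_addr.
Qed.

End Reduction.

Section Pigeonhole.
Variables (d m k : nat) (f : 'I_d -> nat) (e : rel 'I_d).
Hypotheses (m0 : (0 < m)%N) (k0 : (0 < k)%N) (fP : potential m f e).

(* The times at which a walk visits a given node are congruent modulo [m], so
   only [k] residues modulo [m * k] are available to them. *)
Lemma frequent_node_loop i p v : path e i p -> (k < count_mem v (i :: p))%N ->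
  exists u1 u2 u3, [/\ p = u1 ++ u2 ++ u3, last (last i u1) u2 = last i u1,
    u2 != [::] & (m * k %| size u2)%N].
Proof.
move=> pP kv.
suff [s [t [st tp [sv tv] mk]]] : exists s t, [/\ (s < t)%N, (t <= size p)%N,
    nth i (i :: p) s = v /\ nth i (i :: p) t = v & (m * k %| t - s)%N].
  have sp : (s <= size p)%N by exact: leq_trans (ltnW st) tp.
  have tpE : take t p = take s p ++ drop s (take t p).
    by rewrite -{1}(cat_take_drop s (take t p)) take_takel // ltnW.
  exists (take s p), (drop s (take t p)), (drop t p); split.
  - by rewrite catA -tpE cat_take_drop.
  - by rewrite -last_cat -tpE -!nth_last_take // sv tv.
  - by rewrite -size_eq0 size_drop size_takel // subn_eq0 -ltnNge.
  - by rewrite size_drop size_takel.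
pose D := [set s : 'I_(size (i :: p)) | pred1 v (nth i (i :: p) s)].
have kD : (k < #|D|)%N by rewrite -count_card_nth.
have mk0 : (0 < m * k)%N by rewrite muln_gt0 m0.
have Fk s : (s %% (m * k) %/ m < k)%N by rewrite ltn_divLR // [(k * m)%N]mulnC ltn_pmod.
(* Among times that agree modulo [m], this quotient determines the residue modulo [m * k]. *)
pose F (s : 'I_(size (i :: p))) : 'I_k := Ordinal (Fk s).
have [s [t [sD tD st FE]]] : exists s t, [/\ s \in D, t \in D, (s < t)%N & F s = F t].
  apply: contrapT => H; suff : (#|D| <= k)%N by rewrite leqNgt kD.
  rewrite -(card_in_imset (f := F)); first by rewrite -[leqRHS]card_ord max_card.
  move=> s t sD tD FE; apply/val_inj/eqP; rewrite eqn_leq.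
  by apply/andP; split; rewrite leqNgt; apply/negP => st; apply: H;
    [exists t, s|exists s, t]; split.
move: sD tD; rewrite !inE => /eqP sv /eqP tv.
exists s, t; split=> //; first by rewrite -ltnS.
rewrite -eqn_mod_dvd ?(ltnW st) //.
have st_mod : (t == s %[mod m]).
  have /eqP := erefl (f v %% m)%N; rewrite -{1}tv -sv.
  have nthP (r : 'I_(size (i :: p))) : f (nth i (i :: p) r) = f i + r %[mod m].
    rewrite nth_last_take; last by rewrite -ltnS.
    have rp : (r <= size p)%N by rewrite -ltnS.
    rewrite (potential_last (e := e) fP); first by rewrite size_takel.
    by move: pP; rewrite -{1}(cat_take_drop r p) cat_path => /andP[].
  by rewrite !nthP eqn_modDl.
rewrite (divn_eq (t %% (m * k)) m) (divn_eq (s %% (m * k)) m).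
move: FE => /(congr1 val) /= ->.
by rewrite !(modn_dvdm _ (dvdn_mulr k (dvdnn m))) (eqP st_mod).
Qed.

End Pigeonhole.

(** * Cycles as digraphs *)

Lemma leastP (P : nat -> Prop) : (exists n, P n) -> is_least P (least P).
Proof.
move=> [n Pn]; apply: xgetPex.
have exP : exists n, `[< P n >] by exists n; apply/asboolP.
exists (ex_minn exP); case: ex_minnP => k /asboolP Pk kmin; split=> // l Pl.
by apply: kmin; apply/asboolP.
Qed.

Lemma least_le (P : nat -> Prop) n : P n -> (least P <= n)%N.
Proof. by move=> Pn; apply: (leastP (ex_intro _ n Pn)).2. Qed.

Section CycleDigraph.
Variable d : nat.
Implicit Types (z c p : seq 'I_d) (G : digraph d).

Definition cycle_digraph z : digraph d := ([set x in z], [set e in cycle_arcs z]).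

Lemma arel_cycle_digraph z x y :
  arel (cycle_digraph z) x y = (x \in z) && (y == next z x).
Proof.
rewrite /arel inE; apply/mapP/andP => [[t tz [-> ->]]|[xz /eqP ->]];
  first by rewrite eqxx.
by exists x.
Qed.

Lemma via_cycle_digraph z i p : via (cycle_digraph z) i p = has (mem z) (i :: p).
Proof. by apply: eq_has => x /=; rewrite inE. Qed.

Lemma is_cycle_cycle_digraph z : uniq z -> z != [::] -> is_cycle (cycle_digraph z) z.
Proof.
move=> uz z0; apply/and3P; split=> //; apply: cycle_from_next => // x xz.
by rewrite arel_cycle_digraph xz eqxx.
Qed.

Lemma potential_cycle_digraph z : uniq z ->
  potential (size z) (index^~ z) (arel (cycle_digraph z)).
Proof.
move=> uz x y; rewrite arel_cycle_digraph => /andP[xz /eqP ->].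
case: z uz xz => // a s uz xz; rewrite next_nth xz.
have := xz; rewrite -index_mem; set k := index x _ => ks.
have [kS|kS] := ltnP k (size s).
  rewrite (_ : nth a s k = nth a (a :: s) k.+1) // index_uniq //.
rewrite nth_default // (_ : k.+1 = size (a :: s)) ?modnn /= ?eqxx ?mod0n //.
by apply/eqP; rewrite eqn_leq ks.
Qed.

Lemma scc_cyclicity_cycle_digraph z : uniq z -> z != [::] ->
  scc_cyclicity (cycle_digraph z) = size z.
Proof.
move=> uz z0; apply/eqP;
  rewrite eqn_dvd scc_cyclicity_dvd ?is_cycle_cycle_digraph //=.
apply: dvd_scc_cyclicity => c /and3P[c0 uc cc].
case: c c0 uc cc => // a s _ us.
rewrite (cycle_path a) => sP.
apply: (potential_closed (i := last a (a :: s)) (potential_cycle_digraph uz)).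
by rewrite /closed_walk sP /= eqxx.
Qed.

Lemma cycle_arcs_rot n z : uniq z -> cycle_arcs (rot n z) = rot n (cycle_arcs z).
Proof.
by move=> uz; rewrite /cycle_arcs -map_rot; apply: eq_map => x; rewrite next_rot.
Qed.

Lemma cycle_closed_walk (e : rel 'I_d) z x : cycle e z -> x \in z ->
  exists q, [/\ closed_walk e x q, size q = size z, {subset q <= z} &
    uniq z -> perm_eq (walk_arcs x q) (cycle_arcs z)].
Proof.
move=> cz xz; have [n s zE] := rot_to xz; exists (rot 1 (x :: s)).
have sz : size (x :: s) = size z by rewrite -zE size_rot.
have cP : closed_walk e x (rot 1 (x :: s)).
  rewrite rot1_cons /closed_walk last_rcons eqxx andbT.
  by rewrite -[path _ _ _]/(cycle e (x :: s)) -zE rot_cycle.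
split=> //; first by rewrite size_rot.
  by move=> y; rewrite mem_rot -zE mem_rot.
move=> uz; have us : uniq (x :: s) by rewrite -zE rot_uniq.
apply: (perm_trans (closed_cycle_arcs _ _)); rewrite ?rot_uniq //.
  by rewrite rot1_cons last_rcons.
by rewrite -zE !cycle_arcs_rot ?rot_uniq // !perm_rot.
Qed.

(** Turning around [z] realizes every multiple of its length. *)
Lemma ep_cycle_digraph z : uniq z -> ep (size z) (cycle_digraph z) = 0%N.
Proof.
move=> uz; apply/eqP; rewrite -leqn0; apply/bigmax_leqP => x; rewrite inE => xz.
apply: least_le => t /dvdnP[k ->] _.
have z0 : z != [::] by case: (z) xz.
have /and3P[_ _ cz] := is_cycle_cycle_digraph uz z0.
have [q [cq qs _ _]] := cycle_closed_walk cz xz.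
have /andP[qP /eqP ql] := closed_walk_iter k cq.
by exists (flatten (nseq k q)); rewrite size_flatten_nseq qs; split.
Qed.

End CycleDigraph.

(** The property minimized by [Tcr], named so that each instance of it bounds [Tcr]. *)
Definition tcr_threshold (R : realType) (d : nat) (s : nat) (A : 'M[rmax R]_d)
    (G : digraph d) (T : nat) : Prop :=
  forall (i : 'I_d) (p : seq 'I_d),
    path (arel (graph A)) i p -> via G i p -> (T <= size p)%N ->
    exists q : seq 'I_d,
      [/\ path (arel (graph A)) i q /\ last i q = last i p,
          via G i q, cycle_exchange A G i p i q,
          size q = size p %[mod s] & (size q <= T)%N].

(** * Cyclicity classes along a cycle *)

Section CycleRemoval.
Variables (R : realType) (d : nat) (A : 'M[rmax R]_d) (z : seq 'I_d).
Variables (m : nat) (f : 'I_d -> nat).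
Let e := arel (graph A).
Let g := size z.
Let k := (g %/ m)%N.
Hypotheses (zP : is_cycle (graph A) z) (m0 : (0 < m)%N) (fP : potential m f e).

Let uz : uniq z. Proof. by case/and3P: zP. Qed.
Let z0 : z != [::]. Proof. by case/and3P: zP. Qed.

Lemma cycle_class_dvd : (m * k = g)%N.
Proof.
case/and3P: (zP) => _ _ cz; case zE: z z0 => [//|x s] _.
have xz : x \in z by rewrite zE mem_head.
have [q [qP qs _ _]] := cycle_closed_walk cz xz.
by rewrite /k mulnC divnK // /g -qs (potential_closed fP qP).
Qed.

Lemma cycle_class_gt0 : (0 < k)%N.
Proof.
have : (0 < g)%N by rewrite /g lt0n size_eq0.
by rewrite -cycle_class_dvd muln_gt0 => /andP[].
Qed.

Lemma class_shift i c : exists2 s, (s < m)%N & f i + s = c %[mod m].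
Proof.
exists ((c + (m - f i %% m)) %% m)%N; first by rewrite ltn_pmod.
by rewrite modnDmr -modnDml addnCA subnKC ?modnDr // ltnW // ltn_pmod.
Qed.

(** One turn has [m * k] steps and is in the class at one step out of [m]. *)
Lemma cycle_class_count c : (k <= count (in_class m f c) z)%N.
Proof.
case/and3P: (zP) => _ _; case zE: z z0 => [//|x s] _.
rewrite [cycle _ _]/= rcons_path => /andP[sP _].
have [t tm tc] := class_shift x c.
have := class_visits fP m0 sP tc.
have : g = (size s).+1 by rewrite /g zE.
have := cycle_class_dvd; set N := count _ _ => mk gE h.
rewrite leqNgt; apply/negP => Nk.
have : (m * N.+1 <= m * k)%N by rewrite leq_mul2l Nk orbT.
rewrite mk mulnS; lia.
Qed.

Lemma cycle_class_card c : (k <= #|in_class m f c|)%N.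
Proof.
apply: leq_trans (cycle_class_count c) _.
rewrite -size_filter -(card_uniqP (filter_uniq _ uz)).
by apply/subset_leq_card/fintype.subsetP => x; rewrite mem_filter => /andP[].
Qed.

Lemma cycle_quota : (k <= d %/ m)%N.
Proof.
rewrite leq_divRL // mulnC.
case: z z0 => [//|x s] _.
rewrite -[leqRHS](class_card_sum f x m0) -[m in (m * _)%N]card_ord -sum_nat_const.
by apply: leq_sum => s' _; exact: cycle_class_card.
Qed.

End CycleRemoval.

(** [N] is the number of visits to a class with [C] nodes, reached at time [s]. If [C < D], the
    missing node saves [m * k.+1], more than the cost of the offset [s < m]. *)
Lemma removal_arith (d m k g s n N C D r : nat) :
  (s < m)%N -> ((s <= r) && (C <= D) || (C < D))%N -> (n < s + m * N)%N ->
  (N + k <= k.+1 * C)%N -> (k <= C)%N -> (0 < k)%N -> d = (D * m + r)%N ->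
  (m * k)%N = g -> (n <= g * (D - 1) + d - 1)%N.
Proof.
move=> sm hs nN NC kC k0 -> <-; case: D hs => [|D] hs; first by lia.
have [h1 h2] : (m * N + m * k <= m * (k.+1 * C))%N /\
    (m * (k.+1 * C) + s <= m * (k.+1 * D.+1) + r)%N.
  split; first by rewrite -mulnDr leq_mul2l NC orbT.
  case/orP: hs => [/andP[sr CD]|CD].
    by rewrite leq_add // !leq_mul2l CD !orbT.
  have : (m * (k.+1 * C) + m * k.+1 <= m * (k.+1 * D.+1))%N.
    by rewrite -mulnDr -mulnSr !leq_mul2l CD !orbT.
  by rewrite mulnS; lia.
have E : (m * (k.+1 * D.+1) = m * k * D + m * k + D.+1 * m)%N by ring.
by rewrite subn1 /=; lia.
Qed.

(** * The threshold of an arbitrary cycle, through minimal pruned walks *)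

Section RemovalBound.
Variables (R : realType) (d : nat) (A : 'M[rmax R]_d) (z : seq 'I_d).
Variables (m : nat) (f : 'I_d -> nat).
Let e := arel (graph A).
Let g := size z.
Let k := (g %/ m)%N.
Hypotheses (zP : is_cycle (graph A) z) (m0 : (0 < m)%N) (fP : potential m f e).

Let mk : (m * k = g)%N. Proof. exact: cycle_class_dvd zP fP. Qed.
Let k0 : (0 < k)%N. Proof. exact: cycle_class_gt0 zP fP. Qed.

Section Minimal.
Variables (i : 'I_d) (p q1 q2 : seq 'I_d).
Hypothesis qP : pruned A g i p (q1 ++ q2).
Hypothesis qz : last i q1 \in z.
Hypothesis qmin : forall r1 r2, pruned A g i p (r1 ++ r2) -> last i r1 \in z ->
  (size (q1 ++ q2) < size (r1 ++ r2))%N \/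
  size (q1 ++ q2) = size (r1 ++ r2) /\ (size q1 <= size r1)%N.

Let q1P : path e i q1. Proof. by case: qP; rewrite cat_path => /andP[]. Qed.
Let q2P : path e (last i q1) q2. Proof. by case: qP; rewrite cat_path => /andP[]. Qed.

(** More visits would give a loop of length divisible by [g], whose removal shortens the walk and
    keeps the passage through [z]. The two sides of this passage are treated separately, since
    removing a loop that straddles it may destroy it. *)
Lemma minimal_count_prefix v : (count_mem v (i :: q1) <= k)%N.
Proof.
rewrite leqNgt; apply/negP => /(frequent_node_loop m0 k0 fP q1P).
rewrite mk => -[u1 [u2 [u3 [uE ul un gu]]]].
have un' : (0 < size u2)%N by case: (u2) un.
have sz : (size q1 = size (u1 ++ u3) + size u2)%N by rewrite uE !size_cat; lia.
have [||h|[_ h]] := qmin (r1 := u1 ++ u3) (r2 := q2).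
- by rewrite -catA; apply: pruned_cut ul gu; have := qP; rewrite uE -!catA.
- by move: qz; rewrite uE !last_cat ul.
- by move: h; rewrite size_cat sz (size_cat _ q2); lia.
- by move: h; rewrite sz; lia.
Qed.

Lemma minimal_count_suffix v : (count_mem v (last i q1 :: q2) <= k)%N.
Proof.
rewrite leqNgt; apply/negP => /(frequent_node_loop m0 k0 fP q2P).
rewrite mk => -[u1 [u2 [u3 [uE ul un gu]]]].
have sz : (size q2 = size (u1 ++ u3) + size u2)%N by rewrite uE !size_cat; lia.
have un' : (0 < size u2)%N by case: (u2) un.
have [||h|[h _]] := qmin (r1 := q1) (r2 := u1 ++ u3) => //.
- rewrite catA; apply: pruned_cut gu; last by rewrite last_cat.
  by have := qP; rewrite uE -!catA.
- by move: h; rewrite !(size_cat q1) sz; lia.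
- by move: h; rewrite !(size_cat q1) sz; lia.
Qed.

(* A loop at [v] before the passage through [z] could be moved to a visit of
   [v] after it. *)
Lemma minimal_count_shared v : v \in last i q1 :: q2 ->
  (count_mem v (i :: q1) <= 1)%N.
Proof.
move=> vq; rewrite leqNgt; apply/negP => v2.
have /find_loop[u1 [u2 [u3 [uE ul /eqP vl un _]]]] : ~~ uniq (filter (pred1 v) (i :: q1)).
  apply/negP => /(count_uniq_mem v); rewrite count_filter (eq_count (a2 := pred1 v)).
    by move=> h; move: v2; rewrite h; case: (_ \in _).
  by move=> x /=; rewrite andbb.
have ul' : last v u2 = v by rewrite -{1}vl -last_cat ul vl.
have cl : closed_walk e v u2.
  rewrite /closed_walk ul' eqxx andbT.
  by move: q1P; rewrite uE !cat_path vl => /and3P[].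
have q13 : last i (u1 ++ u3) = last i q1.
  by rewrite uE !last_cat vl ul'.
have [r2 [r2P r2l r2E]] := splice q2P cl vq (mem_head v u2).
have r2s : size r2 = (size q2 + size u2)%N.
  by rewrite (perm_walk_size r2E) size_cat !size_walk_arcs.
have qs : size (q1 ++ q2) = (size u1 + size u2 + size u3 + size q2)%N.
  by rewrite uE !size_cat !addnA.
have un' : (0 < size u2)%N by case: (u2) un.
have [||h|[_ h]] := qmin (r1 := u1 ++ u3) (r2 := r2).
- apply: (pruned_perm qP).
  + rewrite cat_path q13 r2P andbT cat_path vl.
    by move: q1P; rewrite uE !cat_path vl ul' => /and3P[-> _ ->].
  + by rewrite last_cat q13 r2l last_cat.
  + rewrite !walk_arcs_cat q13 perm_sym;
      apply: (perm_trans (perm_cat (perm_refl _) r2E)).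
    rewrite uE !walk_arcs_cat vl ul'.
    by rewrite -!catA perm_cat2l perm_sym perm_catCA perm_cat2l perm_catC.
- by rewrite q13.
- by move: h; rewrite qs !size_cat r2s; clear; lia.
- by move: h un'; rewrite uE !size_cat; clear; lia.
Qed.

(** Otherwise the same walk could be split at this earlier node of [z]. *)
Lemma minimal_count_cycle v : v \in z -> v \notin belast i q1.
Proof.
move=> vz; apply/negP => vq.
have {vq} : v \in belast i q1 by []. move=> /(nthP i)[s];
  rewrite size_belast => sq sv.
have lv : last i (take s q1) = v.
  rewrite -nth_last_take ?(ltnW sq) // -sv.
  by rewrite [i :: q1]lastI nth_rcons size_belast sq.
have [||h|[_ h]] := qmin (r1 := take s q1) (r2 := drop s q1 ++ q2).
- by rewrite catA cat_take_drop.
- by rewrite lv.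
- by move: h; rewrite catA cat_take_drop ltnn.
- by move: h; rewrite size_takel ?(ltnW sq) // leqNgt sq.
Qed.

(** A node of [z] is visited only from the end of [q1] on, at most [k] times. A node outside [z]
    that occurs in that part occurs at most once before it; any other node lies in the prefix
    only. *)
Lemma minimal_count v : (count_mem v (i :: q1 ++ q2) <= k + (v \notin z))%N.
Proof.
have -> : i :: q1 ++ q2 = belast i q1 ++ last i q1 :: q2.
  by rewrite -cat_rcons -lastI.
have hs := minimal_count_suffix v; rewrite count_cat.
have pre : (count_mem v (belast i q1) <= count_mem v (i :: q1))%N.
  by rewrite [i :: q1]lastI -cats1 count_cat leq_addr.
have [vz|vz] := boolP (v \in z).
  by rewrite (count_memPn (minimal_count_cycle vz)) addn0.
have [/minimal_count_shared vs|vq] := boolP (v \in last i q1 :: q2).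
  by rewrite addnC leq_add // (leq_trans pre).
rewrite (count_memPn vq) addn0 (leq_trans pre) // (leq_trans (minimal_count_prefix v)) //.
by rewrite leq_addr.
Qed.

(** In the sum of [minimal_count] over the class, each node on [z] saves one visit, and there are at
    least [k] of them. *)
Lemma minimal_class_count c :
  (count (in_class m f c) (i :: q1 ++ q2) + k <= k.+1 * #|in_class m f c|)%N.
Proof.
rewrite count_sum_mem.
apply: (@leq_trans (\sum_(v | in_class m f c v) (k + (v \notin z))
    + count (in_class m f c) z)%N).
  apply: leq_add (cycle_class_count zP m0 fP c).
  by apply: leq_sum => v _; exact: minimal_count.
rewrite big_split /= sum_nat_const mulSn [(_ * k)%N]mulnC -addnA [leqRHS]addnC leq_add2l.
suff -> : (#|in_class m f c| = \sum_(v | in_class m f c v) (v \notin z)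
    + count (in_class m f c) z)%N by [].
rewrite count_sum_mem -big_split /= -sum1_card; apply: eq_bigr => v _.
by rewrite count_uniq_mem; [case: (v \in z)|case/and3P: zP].
Qed.

End Minimal.

Lemma minimal_pruned i p : path e i p -> has (mem z) (i :: p) ->
  exists q1 q2, [/\ pruned A g i p (q1 ++ q2), last i q1 \in z &
    forall r1 r2, pruned A g i p (r1 ++ r2) -> last i r1 \in z ->
    (size (q1 ++ q2) < size (r1 ++ r2))%N \/
    size (q1 ++ q2) = size (r1 ++ r2) /\ (size q1 <= size r1)%N].
Proof.
move=> pP /(has_nthP i)[s]; rewrite ltnS => sp.
rewrite nth_last_take // => sz.
(* The lexicographic order on the two lengths is coded by one number, since [size r1] never exceeds
   [size p]. *)
pose mu (r1 r2 : seq 'I_d) := (size (r1 ++ r2) * (size p).+1 + size r1)%N.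
pose P n := exists q1 q2, [/\ pruned A g i p (q1 ++ q2), last i q1 \in z & mu q1 q2 = n].
have [|[q1 [q2 [qP qz qn]]] min] := @leastP P.
  by eexists; exists (take s p), (drop s p); rewrite cat_take_drop; split=> //;
    exact: pruned_refl.
exists q1, q2; split=> // r1 r2 rP rz.
have : (mu q1 q2 <= mu r1 r2)%N by rewrite qn; apply: min; exists r1, r2.
have : (size r1 < (size p).+1)%N.
  by rewrite ltnS (leq_trans _ (pruned_size rP)) // size_cat leq_addr.
rewrite /mu; move: (size (q1 ++ q2)) (size (r1 ++ r2)) (size q1) (size r1) (size p).+1.
clear=> a b c t N tN le; case: (ltngtP a b) => ab; [by left| |by right; split=> //;
  nia].
by exfalso; nia.
Qed.

Lemma pruned_exchange i p q : pruned A g i p q ->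
  cycle_exchange A (cycle_digraph z) i p i q.
Proof. by move=> [_ _ _ [cs csP E]]; exists (walk_arcs i q), cs, [::]; split;
  rewrite //= cats0. Qed.

(** A minimal pruned walk is the required reduction, with nothing inserted; its visits to a small
    class bound its length. *)
Lemma tcr_threshold_general :
  tcr_threshold g A (cycle_digraph z) (g * (d %/ m - 1) + d - 1).
Proof.
move=> i p pP pz _; rewrite via_cycle_digraph in pz.
have [q1 [q2 [qP qz qmin]]] := minimal_pruned pP pz.
have [q1P q2P q3P _] := qP.
exists (q1 ++ q2); split=> //.
- rewrite via_cycle_digraph; apply/hasP; exists (last i q1) => //.
  by rewrite -cat_cons mem_cat mem_last.
- exact: pruned_exchange.
have [s sm hs] := small_class f i m0.
set c := (f i + s)%N in hs.
have V := class_visits (c := c) fP m0 q1P (erefl _).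
have M := minimal_class_count qP qz qmin c.
have Q := cycle_class_card zP m0 fP c.
have dE := divn_eq d m.
move: hs V M Q k0 dE mk; rewrite -/g -/k.
exact: removal_arith.
Qed.

End RemovalBound.

(** * Splicing families of loops on a walk *)

Section Splicing.
Variables (d : nat) (e : rel 'I_d).
Implicit Types (cs : seq ('I_d * seq 'I_d)).

Definition loops_arcs cs := flatten [seq walk_arcs c.1 c.2 | c <- cs].

Lemma splice_nodes i p r (s : seq ('I_d * 'I_d)) :
  perm_eq (walk_arcs i r) (walk_arcs i p ++ s) -> {subset i :: p <= i :: r}.
Proof.
move=> /(perm_map snd); rewrite map_cat -!/(unzip2 _) !walk_arcs_snd => E x.
by rewrite !inE => /orP[->//|xp]; rewrite (perm_mem E) mem_cat xp orbT.
Qed.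

Lemma splice_loop_nodes i r (s t : seq ('I_d * 'I_d)) :
  perm_eq (walk_arcs i r) (s ++ t) -> {subset unzip2 t <= i :: r}.
Proof.
move=> /(perm_map snd); rewrite map_cat -!/(unzip2 _) walk_arcs_snd => E x xt.
by rewrite inE (perm_mem E) mem_cat xt !orbT.
Qed.

(** Splicing only adds nodes, so a loop that meets [p] still meets the walk built so far. *)
Lemma splice_all i p cs : path e i p ->
    (forall c, c \in cs -> closed_walk e c.1 c.2) ->
    (forall c, c \in cs -> exists2 u, u \in i :: p & u \in c.1 :: c.2) ->
  exists r, [/\ path e i r, last i r = last i p &
    perm_eq (walk_arcs i r) (walk_arcs i p ++ loops_arcs cs)].
Proof.
move=> pP; elim: cs => [|c cs IHcs] cP cu; first by exists p;
  rewrite /loops_arcs /= cats0.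
have [||r [rP rl rE]] := IHcs.
- by move=> c' c's; apply: cP; rewrite inE c's orbT.
- by move=> c' c's; apply: cu; rewrite inE c's orbT.
have [u up uc] := cu c (mem_head _ _).
have [r' [r'P r'l r'E]] := splice rP (cP c (mem_head _ _)) (splice_nodes rE up) uc.
exists r'; split=> //; first by rewrite r'l.
rewrite (perm_trans r'E) // (perm_trans (perm_cat rE (perm_refl _))) //.
by rewrite -catA perm_cat2l perm_catC.
Qed.

Lemma loops_cycles cs : (forall c, c \in cs -> closed_walk e c.1 c.2) ->
  exists2 zs : seq (seq 'I_d), (forall c, c \in zs ->
    [&& c != [::], uniq c & cycle e c])
    & perm_eq (loops_arcs cs) (flatten (map (@cycle_arcs d) zs)).
Proof.
elim: cs => [|c cs IHcs] cP; first by exists [::].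
have [|zs zsP zsE] := IHcs.
  by move=> c' c's; apply: cP; rewrite inE c's orbT.
have [ys ysP ysE] := closed_walk_cycles (cP c (mem_head _ _)).
exists (ys ++ zs); first by move=> c'; rewrite mem_cat => /orP[/ysP|/zsP].
by rewrite map_cat flatten_cat; apply: perm_cat.
Qed.

Lemma size_loops_arcs cs : size (loops_arcs cs) = (\sum_(c <- cs) size c.2)%N.
Proof.
elim: cs => [|c cs IHcs]; first by rewrite big_nil.
by rewrite big_cons -IHcs size_cat size_walk_arcs.
Qed.

Lemma count_loops_arcs (a : pred 'I_d) cs :
  count a (unzip2 (loops_arcs cs)) = (\sum_(c <- cs) count a c.2)%N.
Proof.
elim: cs => [|c cs IHcs]; first by rewrite big_nil.
by rewrite big_cons -IHcs /loops_arcs /= /unzip2 map_cat count_cat -/(unzip2 _) walk_arcs_snd.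
Qed.

Lemma perm_loops_arcs cs ds : perm_eq cs ds ->
  perm_eq (loops_arcs cs) (loops_arcs ds).
Proof. by move=> E; apply/perm_flatten/perm_map. Qed.

End Splicing.

(** Pigeonhole in [a]: this makes two loops, or a loop and a path, share a node of the class. *)
Lemma uniq_filter_meet (T : finType) (a : pred T) (s t : seq T) :
  uniq (filter a s) -> uniq (filter a t) -> (#|a| < count a s + count a t)%N ->
  exists u, [/\ u \in s, u \in t & a u].
Proof.
move=> us ut h; apply: contrapT => H; move: h.
suff : (count a s + count a t <= #|a|)%N by rewrite leqNgt => /negbTE->.
have ust : uniq (filter a s ++ filter a t).
  rewrite cat_uniq us ut andbT /=; apply/hasPn => x;
    rewrite !mem_filter => /andP[ax xt].
  by apply/negP => /andP[_ xs]; apply: H; exists x.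
rewrite -!size_filter -size_cat -(card_uniqP ust).
by apply/subset_leq_card/fintype.subsetP => x;
  rewrite mem_cat !mem_filter => /orP[]/andP[].
Qed.

Lemma uniq_filter_card (T : finType) (a : pred T) (s : seq T) :
  uniq (filter a s) -> (count a s <= #|a|)%N.
Proof.
move=> us; rewrite -size_filter -(card_uniqP us).
by apply/subset_leq_card/fintype.subsetP => x; rewrite mem_filter => /andP[].
Qed.

Lemma sum_le_size (T : eqType) (F : T -> nat) (s : seq T) b :
  {in s, forall x, (F x <= b)%N} -> (\sum_(x <- s) F x <= size s * b)%N.
Proof.
move=> h; rewrite -[leqRHS]/(size s * b)%N -(count_predT s) -sum1_count big_distrl /=.
by rewrite !big_seq; apply: leq_sum => x xs; rewrite mul1n h.
Qed.

Lemma ltn_pred_add D n : (0 < D)%N -> (0 < n)%N -> n != 1%N -> (D < D.-1 + n)%N.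
Proof. lia. Qed.

Lemma lt_neq_pred D n : (n != D.-1)%N -> (n < D)%N -> (n <= D.-2)%N.
Proof. lia. Qed.

(** This and the next two lemmas are the cases of [assembly]: [P], [M] and [Z] count the visits due
    to the path, to the [s] kept loops and to an inserted copy of [z]. Extreme values in the last
    two cases attain [D ^ 2 - D + 2], which is where this constant comes from. *)
Lemma assembly_arith1 D s P M : (1 < D)%N -> (s < D)%N -> (P <= D)%N ->
  (M <= s * D.-1)%N -> (P + M <= D ^ 2 - D + 2)%N.
Proof.
case: D => [//|D] _ sD PD /= MD.
have : (s * D <= D * D)%N by rewrite leq_mul2r -ltnS sD orbT.
have : (D.+1 ^ 2 = D * D + D + D.+1)%N by ring.
lia.
Qed.

Lemma assembly_arith2 D s P M Z : (1 < D)%N -> (s < D)%N -> (P <= 1)%N ->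
  (M <= s * D.-1)%N -> (Z <= D)%N -> (P + M + Z <= D ^ 2 - D + 2)%N.
Proof.
case: D => [//|D] _ sD PD /= MD.
have : (s * D <= D * D)%N by rewrite leq_mul2r -ltnS sD orbT.
have : (D.+1 ^ 2 = D * D + D + D.+1)%N by ring.
lia.
Qed.

Lemma assembly_arith3 D s P M Z : (1 < D)%N -> (s < D)%N -> (P <= D)%N ->
  (M <= s * D.-2)%N -> (Z <= D)%N -> (P + M + Z <= D ^ 2 - D + 2)%N.
Proof.
case: D => [|[|D]] // _ sD PD /= MD.
have : (s * D <= D.+1 * D)%N by rewrite leq_mul2r -ltnS sD orbT.
have : (D.+2 ^ 2 = D.+1 * D + D + D + D + 4)%N by ring.
lia.
Qed.

Lemma cycle_arcs_snd d (z : seq 'I_d) : uniq z -> perm_eq (unzip2 (cycle_arcs z)) z.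
Proof.
move=> uz; rewrite cycle_arcs_zip // unzip2_zip ?size_rot //.
by rewrite perm_rot.
Qed.

(** * The threshold of a cycle that fills a small class *)

Section FullCycleBound.
Variables (R : realType) (d : nat) (A : 'M[rmax R]_d) (z : seq 'I_d).
Variables (m : nat) (f : 'I_d -> nat).
Let e := arel (graph A).
Let g := size z.
Let D := (d %/ m)%N.
Hypotheses (zP : is_cycle (graph A) z) (m0 : (0 < m)%N) (fP : potential m f e).
Hypotheses (gD : (g %/ m)%N = D) (D1 : (1 < D)%N).

Let mD : (m * D = g)%N. Proof. by rewrite -gD; exact: cycle_class_dvd zP fP. Qed.

(** The cycle already has [D] nodes in every class, so a class of at most [D] nodes has no other. *)
Lemma full_class_sub c : (#|in_class m f c| <= D)%N ->
  forall v, in_class m f c v -> v \in z.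
Proof.
move=> cD v vc; apply: contraLR cD => vz; rewrite -ltnNge.
have := cycle_class_count zP m0 fP c; rewrite gD => /leq_ltn_trans; apply.
rewrite -size_filter.
have uz : uniq (filter (in_class m f c) z) by rewrite filter_uniq //; case/and3P: zP.
rewrite -(card_uniqP uz); apply/proper_card/properP; split.
  by apply/fintype.subsetP => x; rewrite mem_filter => /andP[].
by exists v; rewrite // mem_filter (negbTE vz) andbF.
Qed.

Section Assembly.
Variables (i : 'I_d) (p P : seq 'I_d) (cs : seq ('I_d * seq 'I_d)) (c : nat).
Let a := in_class m f c.
Let mu (x : 'I_d * seq 'I_d) := count a x.2.
Hypotheses (PP : path e i P) (Pl : last i P = last i p).
Hypotheses (Pu : uniq (filter a (i :: P))) (Pa : has a (i :: P)).
Hypothesis csP : forall x, x \in cs ->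
  [&& closed_walk e x.1 x.2, a x.1, x.2 != [::] & uniq (filter a x.2)].
Hypothesis pE : perm_eq (walk_arcs i p) (walk_arcs i P ++ loops_arcs cs).
Hypothesis aD : (#|a| <= D)%N.

Let size_loop x : x \in cs -> size x.2 = (m * mu x)%N.
Proof.
move=> /csP/and4P[xc /eqP xa _ _]; have /andP[xp _] := xc.
by rewrite /mu (count_class fP m0 xp xa) mulnC divnK // (potential_closed fP xc).
Qed.

Let mu_gt0 x : x \in cs -> (0 < mu x)%N.
Proof.
move=> xs; have /and4P[_ _ x0 _] := csP xs.
by have := size_loop xs; case: (mu x) => //; rewrite muln0 => /size0nil xE;
  rewrite xE in x0.
Qed.

(* The part of the loops that is kept has no subfamily of total length
   divisible by [g], so that it has less than [D] members, of less than [D]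
   visits each. They are spliced on [P] along [z], unless some member meets
   both [P] and all the other ones. *)
Lemma assembly : exists q, [/\ path e i q /\ last i q = last i p,
    has (mem z) (i :: q), cycle_exchange A (cycle_digraph z) i p i q,
    size q = size p %[mod g] &
    (count a (i :: q) <= D ^ 2 - D + 2)%N].
Proof.
have D0 : (0 < D)%N by exact: ltnW.
(* A loop has length [m * mu x], and [g = m * D]: the discarded family [E] has total length
   divisible by [g]. *)
have [S [E [SE Ediv free]]] := zero_sum_split D mu cs.
have Ssz : (size S < D)%N := zero_sum_free_size D0 free.
have Ssub x : x \in S -> x \in cs by rewrite (perm_mem SE) mem_cat => ->.
have Esub x : x \in E -> x \in cs by rewrite (perm_mem SE) mem_cat => ->;
  rewrite orbT.
have Scl x : x \in S -> closed_walk e x.1 x.2 by move=> /Ssub/csP/and4P[].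
(* A loop visits each node of the class at most once, hence makes at most [D] visits; exactly [D]
   would be a zero-sum singleton. *)
have mu_lt x : x \in S -> (mu x < D)%N.
  move=> xS; have xcs := Ssub _ xS.
  have /and4P[_ _ _ /uniq_filter_card xu] := csP xcs.
  rewrite ltn_neqAle (leq_trans xu) // andbT; apply/eqP => xD.
  have /free : perm_eq S ([:: x] ++ rem x S) by exact: perm_to_rem.
  by rewrite big_seq1 xD dvdnn => /(_ isT).
have az v : a v -> v \in z by exact: full_class_sub.
have Pcount : (count a (i :: P) <= D)%N := leq_trans (uniq_filter_card Pu) aD.
(* In whatever order the pieces are spliced, a walk through [z] with these arcs is an admissible
   reduction. *)
have finish q (ins : seq (seq 'I_d)) : path e i q -> last i q = last i P ->
    has (mem z) (i :: q) ->
    perm_eq (walk_arcs i q) (walk_arcs i P ++ loops_arcs S ++ flatten (map (@cycle_arcs d) ins)) ->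
    all (is_cycle (cycle_digraph z)) ins ->
      (g %| size (flatten (map (@cycle_arcs d) ins)))%N ->
    [/\ path e i q /\ last i q = last i p, has (mem z) (i :: q),
       cycle_exchange A (cycle_digraph z) i p i q & size q = size p %[mod g]].
  move=> qP ql qz qE insP insg.
  have pE' : perm_eq (walk_arcs i p) ((walk_arcs i P ++ loops_arcs S) ++ loops_arcs E).
    rewrite (perm_trans pE) // -catA perm_cat2l (perm_trans (perm_loops_arcs SE)) //.
    by rewrite /loops_arcs map_cat flatten_cat.
  split=> //; first by rewrite ql Pl.
    have [x /Esub/csP/and4P[] //|zs zsP zsE] := @loops_cycles d e E.
    exists (walk_arcs i P ++ loops_arcs S), zs, ins; split=> //.
    - exact/allP.
    - by rewrite (perm_trans pE') // perm_cat2l.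
    - by rewrite -catA.
  rewrite (perm_walk_size pE') (perm_walk_size qE) catA !(size_cat (_ ++ _)).
  apply/eqP; rewrite eqn_modDl (eqP insg) eq_sym -/(dvdn _ _) size_loops_arcs.
  rewrite (_ : \sum_(x <- E) size x.2 = m * \sum_(x <- E) mu x)%N; last first.
    by rewrite big_distrr /= !big_seq; apply: eq_bigr => x /Esub/size_loop.
  by rewrite -mD dvdn_pmul2l.
pose big_meets := exists x, [/\ x \in S, mu x = D.-1 &
  exists u, [/\ u \in i :: P, u \in x.2 & a u]].
have [[x [xS xD [u [uP ux ua]]]]|nobig] := pselect big_meets.
  have SxE := perm_to_rem xS.
  have [r1 [r1P r1l r1E]] := splice PP (Scl x xS) uP (mem_behead (s :=
    x.1 :: x.2) ux).
  have [||r [rP rl rE]] := @splice_all d e i r1 (rem x S) r1P.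
  - by move=> y /mem_rem/Scl.
  - move=> y yS; have yS' := mem_rem yS.
    have /and4P[_ _ _ xu] := csP (Ssub _ xS).
    have /and4P[_ _ _ yu] := csP (Ssub _ yS').
    have [|w [wx wy _]] := uniq_filter_meet xu yu.
      apply: leq_ltn_trans aD _; rewrite -/(mu x) -/(mu y) xD.
      have y0 := mu_gt0 (Ssub _ yS').
      (* A loop with a single visit would form with [x] a family of sum [D]. So [y] makes at least
         two visits, which with the [D - 1] of [x] exceed the size of the class, and the loops
         meet. *)
      have y1 : mu y != 1%N.
        apply/eqP => y1; have /free : perm_eq S ([:: x; y] ++ rem y (rem x S)).
          by rewrite (perm_trans SxE) // perm_cons perm_to_rem.
        by rewrite !big_cons big_nil xD y1 addn0 addn1 prednK // dvdnn => /(_ isT).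
      exact: ltn_pred_add.
    exists w; last by rewrite inE wy orbT.
    by apply: (splice_loop_nodes r1E); rewrite walk_arcs_snd.
  exists r.
  have qE : perm_eq (walk_arcs i r) (walk_arcs i P ++ loops_arcs S ++ [::]).
    rewrite cats0 (perm_trans rE) // (perm_trans (perm_cat r1E (perm_refl _))) //.
    rewrite -catA perm_cat2l perm_sym.
    by rewrite (perm_trans (perm_loops_arcs SxE)).
  have uz : has (mem z) (i :: r).
    apply/hasP; exists u; last exact: az.
    by apply: (splice_nodes rE); apply: (splice_nodes r1E).
  have [] := finish r [::] rP _ uz qE isT (dvdn0 _); first by rewrite rl.
  move=> h1 h2 h3 h4; split=> //.
  have h5 := perm_walk_count a qE.
  rewrite cats0 /unzip2 map_cat -!/(unzip2 _) count_cat walk_arcs_snd count_loops_arcs in h5.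
  have h6 : (\sum_(x <- S) mu x <= size S * D.-1)%N.
    by apply: sum_le_size => y /mu_lt yD; rewrite -ltnS prednK.
  have -> : (count a (i :: r) = count a (i :: P) + \sum_(x <- S) mu x)%N.
    by rewrite /= h5 addnA.
  exact: assembly_arith1 D1 Ssz Pcount h6.
(* Otherwise one copy of [z] is spliced first: it contains the whole class, so every kept loop meets
   it. *)
have /hasP[w wP wa] := Pa.
have wz : w \in z by exact: az.
have /and3P[z0 uz cz] := zP.
have [zq [zqP zqs zqz /(_ uz) zqE]] := cycle_closed_walk cz wz.
have [r1 [r1P r1l r1E]] := splice PP zqP wP (mem_head w zq).
have zr1 v : v \in z -> v \in i :: r1.
  move=> vz; apply: (splice_loop_nodes r1E); rewrite walk_arcs_snd.
  by have/perm_mem -> : perm_eq zq z by rewrite -(walk_arcs_snd w zq) (perm_trans (perm_map snd zqE)) // cycle_arcs_snd.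
have [|r [rP rl rE]] := @splice_all d e i r1 S r1P Scl.
  by move=> y /Ssub/csP/and4P[_ ya _ _]; exists y.1; rewrite ?mem_head ?zr1 ?az.
have qE : perm_eq (walk_arcs i r) (walk_arcs i P ++ loops_arcs S ++ flatten (map (@cycle_arcs d) [:: z])).
  rewrite (perm_trans rE) // (perm_trans (perm_cat r1E (perm_refl _))) //.
  by rewrite -catA perm_cat2l perm_catC perm_cat2l /= cats0.
have wr : has (mem z) (i :: r).
  by apply/hasP; exists w => //; apply: (splice_nodes rE); apply: zr1.
have rl' : last i r = last i P by rewrite rl.
have zall : all (is_cycle (cycle_digraph z)) [:: z] by rewrite /= is_cycle_cycle_digraph.
have zdvd : (g %| size (flatten (map (@cycle_arcs d) [:: z])))%N by rewrite /= cats0 size_map.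
have [h1 h2 h3 h4] := finish r [:: z] rP rl' wr qE zall zdvd.
exists r; split=> //.
have h5 := perm_walk_count a qE.
rewrite [flatten _]cats0 /unzip2 !map_cat -!/(unzip2 _) !count_cat walk_arcs_snd count_loops_arcs in h5.
have h7 : (count a z <= D)%N.
  by apply: leq_trans aD; apply: uniq_filter_card; rewrite filter_uniq.
have -> : (count a (i :: r) = count a (i :: P) + \sum_(x <- S) mu x + count a z)%N.
  by rewrite /= h5 !addnA; congr (_ + _)%N; apply/permP/cycle_arcs_snd.
(* The copy of [z] has to be compensated. A kept loop with [D - 1] visits does not meet the path in
   the class, which leaves at most one visit to the path; without such a loop, each one makes at
   most [D - 2] visits. *)
have [/hasP[x xS /eqP xD]|/hasPn nox] := boolP (has (fun x => mu x == D.-1) S).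
  have h6 : (\sum_(x <- S) mu x <= size S * D.-1)%N.
    by apply: sum_le_size => y /mu_lt yD; rewrite -ltnS prednK.
  have P1 : (count a (i :: P) <= 1)%N.
    rewrite leqNgt; apply/negP => P2; apply: nobig; exists x; split=> //.
    have /and4P[_ _ _ xu] := csP (Ssub _ xS).
    have [|u [uP ux ua]] := uniq_filter_meet Pu xu; last by exists u.
    by rewrite -/(mu x) xD (leq_ltn_trans aD) // addnC ltn_pred_add // ?(ltnW P2) // gtn_eqF.
  exact: assembly_arith2 D1 Ssz P1 h6 h7.
have h6 : (\sum_(x <- S) mu x <= size S * D.-2)%N.
  apply: sum_le_size => y yS; have := mu_lt _ yS; have := nox y yS.
  by move=> n1 n2; exact: lt_neq_pred.
exact: assembly_arith3 D1 Ssz Pcount h6 h7.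
Qed.

End Assembly.

Lemma tcr_threshold_full :
  tcr_threshold g A (cycle_digraph z) (m * (D ^ 2 - D + 2) + d %% m - 1).
Proof.
move=> i p pP pz pT.
have [s sm hs] := small_class f i m0.
set c := (f i + s)%N in hs.
(* Every class has at least [D] nodes, which rules out the second alternative of [small_class]. *)
have cD : (D <= #|in_class m f c|)%N by rewrite -gD;
  exact: cycle_class_card zP m0 fP c.
have [sr aD] : (s <= d %% m)%N /\ (#|in_class m f c| <= D)%N.
  by case/orP: hs => [/andP[]//|]; rewrite ltnNge cD.
have fc : f i + s = c %[mod m] by [].
(* The threshold is at least [s], so a walk of this length lives until time [s], when it is in the
   class. *)
have pa : has (in_class m f c) (i :: p).
  rewrite has_count lt0n; apply/negP => /eqP c0.
  have := class_visits fP m0 pP fc; rewrite c0 muln0 addn0 ltnNge => /negP; apply.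
  apply: leq_trans pT; move: sm sr m0; clear; nia.
have [P [cs [PP Pl Pu /(_ pa) Pa [csP pE]]]] := loop_erasure (in_class m f c) pP.
have [q [[qP ql] qz qE qs qc]] := assembly PP Pl Pu Pa csP pE aD.
exists q; split=> //; first by rewrite via_cycle_digraph.
have := class_visits fP m0 qP fc.
have : (m * count (in_class m f c) (i :: q) <= m * (D ^ 2 - D + 2))%N by rewrite leq_mul2l qc orbT.
move: sr; move: (count _ _) (D ^ 2 - D + 2)%N; clear; lia.
Qed.
End FullCycleBound.

(** * A representing subgraph of shortest critical cycles *)

Section Components.
Variable d : nat.
Implicit Types (G H K : digraph d) (c z p : seq 'I_d).

Lemma arel_component G i x y : arel (component G i) x y =
  [&& arel G x y, x \in nodes (component G i) & y \in nodes (component G i)].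
Proof. by rewrite /arel inE. Qed.

Lemma component_refl G i : i \in nodes G -> i \in nodes (component G i).
Proof. by move=> iG; rewrite inE iG connect0. Qed.

Lemma component_eq G i j : j \in nodes (component G i) ->
  component G j = component G i.
Proof.
rewrite inE => /and3P[jG ij ji].
suff E : nodes (component G j) = nodes (component G i).
  rewrite /component; congr (_, _); first exact: E.
  by apply/setP => x; rewrite !inE; move/setP: E => E; have := E x.1; have :=
    E x.2; rewrite !inE => -> ->.
apply/setP => x; rewrite !inE; congr (_ && _).
apply/andP/andP => -[h1 h2]; split.
- exact: connect_trans ij h1.
- exact: connect_trans h2 ji.
- exact: connect_trans ji h1.
- exact: connect_trans h2 ij.
Qed.

Lemma scc_eq G H K x : H \in sccs G -> K \in sccs G ->
  x \in nodes H -> x \in nodes K -> H = K.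
Proof.
by move=> /imsetP[i _ ->] /imsetP[j _ ->] /component_eq <- /component_eq <-.
Qed.

Lemma scc_nodes_sub G K x : K \in sccs G -> x \in nodes K -> x \in nodes G.
Proof. by move=> /imsetP[i _ ->]; rewrite inE => /andP[]. Qed.

Lemma scc_connect G K x y : K \in sccs G -> x \in nodes K -> y \in nodes K ->
  connect (arel G) x y.
Proof.
move=> /imsetP[i _ ->]; rewrite !inE => /and3P[_ _ xi] /and3P[_ iy _].
exact: connect_trans xi iy.
Qed.

Lemma scc_arel G K x y : K \in sccs G -> arel K x y ->
  [/\ arel G x y, x \in nodes K & y \in nodes K].
Proof. by move=> /imsetP[i _ ->]; rewrite arel_component => /and3P[]. Qed.

Lemma is_cycle_sub G H c : (forall x y, arel G x y -> arel H x y) ->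
  is_cycle G c -> is_cycle H c.
Proof. by move=> GH /and3P[c0 uc cc]; apply/and3P; split=> //;
  exact: sub_cycle cc. Qed.

Lemma scc_is_cycle G K c : K \in sccs G -> is_cycle K c -> is_cycle G c.
Proof. by move=> KG; apply: is_cycle_sub => x y /(scc_arel KG)[]. Qed.

Lemma scc_cycle_sub G K c : K \in sccs G -> is_cycle K c -> {subset c <= nodes K}.
Proof.
move=> KG /and3P[_ _ cc] x xc.
by have /(scc_arel KG)[] := next_cycle cc xc.
Qed.

Lemma cycle_in_component G c i : wf_digraph G -> is_cycle G c -> i \in c ->
  is_cycle (component G i) c.
Proof.
move=> wfG /and3P[c0 uc cc] ic; apply/and3P; split=> //.
have cn x : x \in c -> x \in nodes (component G i).
  move=> xc; rewrite inE !(connect_cycle cc) // !andbT.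
  by have /wfG[] := next_cycle cc xc.
apply: cycle_from_next => // x xc.
by rewrite arel_component (next_cycle cc xc) !cn ?mem_next.
Qed.

Lemma scc_in G i : i \in nodes G -> component G i \in sccs G.
Proof. exact: imset_f. Qed.

End Components.

Section Critical.
Variables (R : realType) (d : nat) (A : 'M[rmax R]_d).
Let crit := critical_graph A.

Lemma cycle_arcs_mem (c : seq 'I_d) x y : (x, y) \in cycle_arcs c ->
  (x \in c) && (y == next c x).
Proof. by move=> /mapP[t tc [-> ->]]; rewrite tc eqxx. Qed.

Lemma critical_arcP x y : reflect (exists2 c, critical_cycle A c & (x, y) \in cycle_arcs c)
  (arel crit x y).
Proof. by rewrite /arel inE; exact: asboolP. Qed.

Lemma critical_nodeP x : reflect (exists2 c, critical_cycle A c & x \in c) (x \in nodes crit).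
Proof. by rewrite inE; exact: asboolP. Qed.

Lemma critical_wf : wf_digraph crit.
Proof.
move=> x y /critical_arcP[c cc /cycle_arcs_mem/andP[xc /eqP yE]].
by split; apply/critical_nodeP; exists c; rewrite // yE mem_next.
Qed.

Lemma critical_sub x y : arel crit x y -> arel (graph A) x y.
Proof.
move=> /critical_arcP[c [/and3P[_ _ cc] _] /cycle_arcs_mem/andP[xc /eqP ->]].
exact: next_cycle cc xc.
Qed.

Lemma critical_is_cycle c : critical_cycle A c -> is_cycle crit c.
Proof.
move=> cc; have [/and3P[c0 uc cP] _] := cc; apply/and3P; split=> //.
apply: cycle_from_next => // x xc; apply/critical_arcP; exists c => //.
by apply/mapP; exists x.
Qed.

Definition girth_cycle (K : digraph d) : seq 'I_d :=
  xget [::] (fun z => is_cycle K z /\ size z = girth K).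

Lemma girth_cycleP K : K \in sccs crit ->
  is_cycle K (girth_cycle K) /\ size (girth_cycle K) = girth K.
Proof.
move=> /imsetP[i ic ->].
suff /(xgetPex [::]) :
  exists z, is_cycle (component crit i) z /\ size z = girth (component crit i) by [].
have /critical_nodeP[c cc ci] := ic.
have cK := cycle_in_component critical_wf (critical_is_cycle cc) ci.
have [[z zK zs] _] := leastP (P :=
  fun n => exists2 c, is_cycle (component crit i) c & size c = n)
  (ex_intro _ _ (ex_intro2 _ _ c cK erefl)).
by exists z.
Qed.

Lemma girth_cycle_uniq K : K \in sccs crit -> uniq (girth_cycle K).
Proof. by move=> /girth_cycleP[/and3P[]]. Qed.

Lemma girth_cycle_neq0 K : K \in sccs crit -> girth_cycle K != [::].
Proof. by move=> /girth_cycleP[/and3P[]]. Qed.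

Lemma girth_cycle_crit K : K \in sccs crit -> is_cycle crit (girth_cycle K).
Proof. by move=> KS; have [/(scc_is_cycle KS)] := girth_cycleP KS. Qed.

Lemma girth_cycle_graph K : K \in sccs crit -> is_cycle (graph A) (girth_cycle K).
Proof. by move=> /girth_cycle_crit; apply: is_cycle_sub; exact: critical_sub. Qed.

Lemma girth_cycle_nodes K : K \in sccs crit -> {subset girth_cycle K <= nodes K}.
Proof. by move=> KS; have [/(scc_cycle_sub KS)] := girth_cycleP KS. Qed.

Lemma girth_cycle_inj K H x : K \in sccs crit -> H \in sccs crit ->
  x \in girth_cycle K -> x \in girth_cycle H -> K = H.
Proof. by move=> KS HS /(girth_cycle_nodes KS) xK /(girth_cycle_nodes HS);
  exact: scc_eq KS HS xK. Qed.

Definition girth_subgraph : digraph d :=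
  (\bigcup_(K in sccs crit) [set x in girth_cycle K],
   \bigcup_(K in sccs crit) [set e in cycle_arcs (girth_cycle K)]).

Lemma girth_subgraph_nodeP x : reflect (exists2 K, K \in sccs crit & x \in girth_cycle K)
  (x \in nodes girth_subgraph).
Proof.
by apply: (iffP bigcupP) => -[K KS xK]; exists K => //; move: xK; rewrite inE.
Qed.

Lemma girth_subgraph_arcP x y : reflect (exists K, [/\ K \in sccs crit,
    x \in girth_cycle K & y = next (girth_cycle K) x])
  (arel girth_subgraph x y).
Proof.
apply: (iffP bigcupP) => [[K KS]|[K [KS xK yE]]].
  by rewrite inE => /cycle_arcs_mem/andP[xK /eqP yE]; exists K.
by exists K => //; rewrite inE yE; apply/mapP; exists x.
Qed.

(** Cycles from different components are disjoint, so the only arc leaving a node of the union is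
    that of its own cycle. *)
Lemma girth_subgraph_component K x : K \in sccs crit -> x \in girth_cycle K ->
  component girth_subgraph x = cycle_digraph (girth_cycle K).
Proof.
move=> KS xK.
have step u v : u \in girth_cycle K ->
  arel girth_subgraph u v = (v == next (girth_cycle K) u).
  move=> uK; apply/girth_subgraph_arcP/eqP => [[H [HS uH ->]]|->]; last by exists K.
  by rewrite (girth_cycle_inj KS HS uK uH).
have cyc : cycle (arel girth_subgraph) (girth_cycle K).
  by apply: cycle_from_next => [|u uK]; rewrite ?girth_cycle_uniq // step.
have conn u : connect (arel girth_subgraph) x u -> u \in girth_cycle K.
  move=> /connectP[q qP ->]; elim: q x xK qP => //= v q IHq w uK /andP[uv qP].
  by apply: IHq qP; rewrite step // in uv; rewrite (eqP uv) mem_next.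
have nodesE : nodes (component girth_subgraph x) = [set u in girth_cycle K].
  apply/setP => u; rewrite !inE; apply/and3P/idP => [[_ /conn]//|uK].
  split; [|exact: (connect_cycle cyc)|exact: (connect_cycle cyc)].
  by apply/girth_subgraph_nodeP; exists K.
rewrite [LHS]surjective_pairing -[_.1]/(nodes _) nodesE; congr (_, _).
apply/setP => -[u v]; rewrite -[LHS]/(arel (component girth_subgraph x) u v).
rewrite arel_component nodesE -[RHS]/(arel (cycle_digraph (girth_cycle K)) u v).
rewrite arel_cycle_digraph !inE andbC.
case uK: (u \in girth_cycle K) => //=; rewrite step // andbC.
by case: eqP => // ->; rewrite mem_next uK.
Qed.

Lemma girth_subgraph_sccs :
  sccs girth_subgraph = [set cycle_digraph (girth_cycle K) | K in sccs crit].
Proof.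
apply/setP => H; apply/imsetP/imsetP => [[x /girth_subgraph_nodeP[K KS xK] ->]|[K KS ->]].
  by exists K => //; exact: girth_subgraph_component.
have := girth_cycle_neq0 KS; case zE: (girth_cycle K) => [//|x s] _.
have xK : x \in girth_cycle K by rewrite zE mem_head.
by exists x; rewrite -?zE ?(girth_subgraph_component KS) //;
  apply/girth_subgraph_nodeP; exists K.
Qed.

Lemma girth_subgraph_representing : representing A girth_subgraph.
Proof.
split.
- move=> x y /girth_subgraph_arcP[K [KS xK ->]].
  by split; apply/girth_subgraph_nodeP; exists K; rewrite ?mem_next.
- apply/andP; split; apply/fintype.subsetP.
    move=> x /girth_subgraph_nodeP[K KS /(girth_cycle_nodes KS)];
      exact: scc_nodes_sub.
  move=> [x y] /girth_subgraph_arcP[K [KS xK ->]].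
  by have /and3P[_ _ /next_cycle] := girth_cycle_crit KS; apply.
- move=> H H'; rewrite girth_subgraph_sccs => /imsetP[K KS ->] /imsetP[K' KS' ->] HH x y.
  rewrite !inE => xK yK'; apply: contra HH => /girth_subgraph_arcP[L [LS xL yE]].
  rewrite (girth_cycle_inj KS LS xK xL) (@girth_cycle_inj K' L y) //.
  by rewrite yE mem_next.
- move=> H; rewrite girth_subgraph_sccs => /imsetP[K KS ->].
  by exists (girth_cycle K); apply: is_cycle_cycle_digraph;
    rewrite ?girth_cycle_uniq ?girth_cycle_neq0.
- move=> K KS; apply/eqP/cards1P; exists (cycle_digraph (girth_cycle K)).
  apply/setP => H; rewrite inE girth_subgraph_sccs inE;
    apply/andP/eqP => [[/imsetP[L LS ->]]|->].
    move=> /andP[/fintype.subsetP LK _]; have := girth_cycle_neq0 LS.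
    case zE: (girth_cycle L) => [//|x s] _; rewrite -zE.
    have xL : x \in girth_cycle L by rewrite zE mem_head.
    congr (cycle_digraph (girth_cycle _)); apply: scc_eq (LS) (KS) _ _.
      exact: girth_cycle_nodes xL.
    by apply: LK; rewrite inE.
  split; first exact: imset_f.
  apply/andP; split; apply/fintype.subsetP.
    by move=> x; rewrite inE => /(girth_cycle_nodes KS).
  move=> [x y]; rewrite inE => /cycle_arcs_mem/andP[xK /eqP ->].
  by have [/and3P[_ _ /next_cycle] + _] := girth_cycleP KS; apply.
Qed.

(** The term of [csr_bound] for this cycle, whose cyclicity is its length and whose exploration
    penalty is 0. *)
Definition removal_penalty (K : digraph d) : nat :=
  (Tcr (girth K) A (cycle_digraph (girth_cycle K)) + 1 - girth K)%N.

Lemma csr_bound_girth_subgraph :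
  csr_bound A girth_subgraph = (\max_(K in sccs crit) removal_penalty K)%N.
Proof.
rewrite /csr_bound girth_subgraph_sccs big_imset /=; last first.
  move=> K L KS LS /(congr1 fst) /setP E; have := girth_cycle_neq0 KS.
  case zE: (girth_cycle K) => [//|x s] _.
  have xK : x \in girth_cycle K by rewrite zE mem_head.
  by apply: (girth_cycle_inj KS LS xK); have := E x; rewrite !inE xK => <-.
apply: eq_bigr => K KS; have [_ zs] := girth_cycleP KS.
rewrite scc_cyclicity_cycle_digraph ?girth_cycle_uniq ?girth_cycle_neq0 //.
by rewrite ep_cycle_digraph ?girth_cycle_uniq // addn0 zs.
Qed.

End Critical.

(** * From thresholds to the two bounds *)

Lemma penalty_arith1 (m k D r g T : nat) : (0 < m)%N -> (0 < k)%N -> (k <= D)%N ->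
  (m * k)%N = g -> (T <= g * (D - 1) + (D * m + r) - 1)%N ->
  (k = D -> (1 < D)%N -> (T <= m * (D ^ 2 - D + 2) + r - 1)%N) ->
  (T + 1 - g <= m * Wi D + r)%N.
Proof.
move=> m0 k0 kD gE T1 T2; case: (ltngtP 1%N D) => D1; last 2 first.
- by case: D kD D1 {T1 T2} => // kD _; case: (k) k0 kD.
- rewrite -D1 /Wi /= muln0 add0n; have k1 : k = 1%N by lia.
  by rewrite -gE k1; rewrite -D1 subnn muln0 in T1; lia.
have WE : Wi D = (D ^ 2 + 2 - 2 * D)%N by rewrite /Wi D1; nia.
have D2 : (2 * D <= D ^ 2)%N by rewrite -mulnn leq_mul2r D1 orbT.
(* For [k < D] the general threshold suffices, as [k * (D - 2) + D] is at most
   [(D - 1) * (D - 2) + D = Wi D]. For [k = D], subtracting [g = m * D] from the threshold of a full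
   cycle leaves exactly [m * Wi D + r]. *)
rewrite WE; case: (ltngtP k D) kD => // kD _.
  have h : (m * (k * (D - 2) + D) <= m * (D ^ 2 + 2 - 2 * D))%N.
    rewrite leq_mul2l; apply/orP; right.
    have : (k * (D - 2) <= D.-1 * (D - 2))%N by rewrite leq_mul2r -ltnS prednK ?kD ?orbT // ltnW.
    case: D D1 D2 {WE T1 T2 kD} => [|[|D]] // _ _; rewrite subn2 /=; nia.
  have E : (m * (k * (D - 2) + D) + g = g * (D - 1) + D * m)%N.
    by rewrite -gE; case: D D1 {D2 WE T1 T2 kD h} => [|[|D]] // _;
      rewrite subn2 subn1 /=; ring.
  by lia.
have {}T2 := T2 kD D1; rewrite kD in gE.
have E : (m * (D ^ 2 - D + 2) = m * (D ^ 2 + 2 - 2 * D) + g)%N.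
  by rewrite -gE -mulnDr; congr (_ * _)%N; lia.
by move: T2; rewrite E; lia.
Qed.

(** For [D >= 2] the bound grows with [g], which may be replaced by [h]. For [D = 1] the coefficient
    [D - 2] is negative, and [h <= m * D] is what saves the inequality. *)
Lemma penalty_arith2 (m k D r g h T : nat) : (0 < m)%N -> (0 < k)%N -> (k <= D)%N ->
  (m * k)%N = g -> (g <= h)%N -> (h <= m * D)%N ->
  (T <= g * (D - 1) + (D * m + r) - 1)%N ->
  ((T + 1 - g)%N%:Z <= h%:Z * (D%:Z - 2) + (D * m + r)%N%:Z :> int).
Proof.
move=> m0 k0 kD gE gh hD T1.
have gm : (m <= g)%N by rewrite -gE leq_pmulr.
case: D kD hD T1 => [|[|D]] kD hD T1; first by lia.
  by rewrite subnn muln0 in T1; lia.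
have : (g * D <= h * D)%N by rewrite leq_mul2r gh orbT.
have : (g * (D.+2 - 1) = g * D + g)%N by rewrite subn1 /= mulnSr.
have : h%:Z * (D.+2%:Z - 2) = (h * D)%N%:Z by rewrite PoszM; congr (_ * _); lia.
move: T1; rewrite -!/(leq _ _); move: (h * D)%N (g * D)%N => X Y; lia.
Qed.

Section PenaltyBounds.
Variables (R : realType) (d : nat) (A : 'M[rmax R]_d).
Hypothesis irrA : mp_irreducible A.
Let crit := critical_graph A.
Let gamma := scc_cyclicity (graph A).

Lemma graph_connect i j : connect (arel (graph A)) i j.
Proof. by case: irrA => _ sc _; apply: sc; rewrite inE. Qed.

Lemma graph_potential : exists f, potential gamma f (arel (graph A)).
Proof.
case: irrA => d0 _ _; apply: (@potential_exists d (graph A) (Ordinal d0)).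
exact: graph_connect.
Qed.

Lemma cyclicity_gt0 z : is_cycle (graph A) z -> (0 < gamma)%N.
Proof.
move=> zP; apply: dvdn_gt0 (scc_cyclicity_dvd zP); rewrite lt0n size_eq0.
by case/and3P: zP.
Qed.

Lemma girth_facts K : K \in sccs crit -> exists k,
  [/\ (0 < gamma)%N, (0 < k)%N, (k <= d %/ gamma)%N, (gamma * k)%N = girth K &
    (Tcr (girth K) A (cycle_digraph (girth_cycle K))
       <= girth K * (d %/ gamma - 1) + d - 1)%N /\
    (k = (d %/ gamma)%N -> (1 < d %/ gamma)%N ->
     (Tcr (girth K) A (cycle_digraph (girth_cycle K))
       <= gamma * ((d %/ gamma) ^ 2 - d %/ gamma + 2) + d %% gamma - 1)%N)].
Proof.
move=> KS; have zP := girth_cycle_graph KS; have [f fP] := graph_potential.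
have g0 := cyclicity_gt0 zP; have [_ <-] := girth_cycleP KS.
exists (size (girth_cycle K) %/ gamma)%N; split=> //.
- exact: cycle_class_gt0 zP fP.
- exact: cycle_quota zP g0 fP.
- exact: cycle_class_dvd zP fP.
- split=> [|kD D1]; apply: least_le.
    exact: tcr_threshold_general zP g0 fP.
  exact: tcr_threshold_full zP g0 fP kD D1.
Qed.

Lemma penalty_bounds (T1 : nat) :
  (T1 <= \max_(K in sccs crit) removal_penalty A K)%N ->
  (T1 <= gamma * Wi (d %/ gamma) + d %% gamma)%N /\
  T1%:Z <= (max_girth_critical A)%:Z * ((d %/ gamma)%N%:Z - 2) + d%:Z.
Proof.
(* Without critical components both maxima are 0; otherwise a component of largest penalty gives
   both bounds. *)
move=> T1b; have [S0|S0] := posnP #|sccs crit|.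
  have T0 : T1 = 0%N.
    by apply/eqP; rewrite -leqn0; move: T1b; rewrite big_pred0 // => K;
      rewrite (card0_eq S0).
  have -> : max_girth_critical A = 0%N.
    by rewrite /max_girth_critical big_pred0 // => K; rewrite (card0_eq S0).
  by rewrite T0 mul0r add0r.
have [K KS KE] := eq_bigmax_cond (removal_penalty A) S0.
have [k [m0 k0 kD gE [t1 t2]]] := girth_facts KS.
rewrite KE in T1b; have dE := divn_eq d gamma.
rewrite [X in (_ + X - 1)%N]dE in t1; split.
  apply: leq_trans T1b _; exact: penalty_arith1 m0 k0 kD gE t1 t2.
apply: le_trans (_ : (removal_penalty A K)%:Z <= _); first by rewrite lez_nat.
rewrite [X in _ <= _ + X%:Z]dE -/gamma.
apply: penalty_arith2 m0 k0 kD gE _ _ t1.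
  exact: (@leq_bigmax_cond _ _ (@girth d) K).
apply/bigmax_leqP => L LS; have [l [_ _ lD <- _]] := girth_facts LS.
by rewrite leq_mul2l lD orbT.
Qed.

End PenaltyBounds.

(** * Max-plus powers as weights of walks *)

Section RmaxOrder.
Variable R : realType.
Implicit Types x y w : rmax R.

Lemma rmax_add_le x y w : (x + y <= w) = (x <= w) && (y <= w).
Proof.
case: x y w => [a|] [b|] [c|] //=; rewrite ?andbT ?andbF //.
by rewrite -[LHS]/(Num.max a b <= c) ge_max.
Qed.


Lemma rmax_add_maxP x y : x + y = x \/ x + y = y.
Proof.
case: x y => [a|] [b|]; [|by left|by right|by left].
by rewrite /GRing.add /= /Num.max; case: ifP; [right|left].
Qed.

Lemma rmax_le_sum (I : finType) (P : pred I) (F : I -> rmax R) k : P k ->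
  F k <= \sum_(k | P k) F k.
Proof.
move=> Pk; rewrite (bigD1 k) //=.
by have := lexx (F k + \sum_(i | P i && (i != k)) F i);
  rewrite rmax_add_le => /andP[].
Qed.

Lemma rmax_sum_attained (I : finType) (P : pred I) (F : I -> rmax R) :
  \sum_(k | P k) F k != 0 -> exists2 k, P k & \sum_(k | P k) F k = F k.
Proof.
elim/big_rec: _ => [|k x Pk IH]; first by rewrite eqxx.
have [->|->] := rmax_add_maxP (F k) x; first by exists k.
exact: IH.
Qed.

Lemma rmax_mul_le x y w : x <= y -> w * x <= w * y.
Proof. by case: x y w => [a|] [b|] [c|] //; rewrite /Order.le /= => h;
  rewrite lerD2l. Qed.

Lemma rmax_mul_le2 x y x' y' : x <= x' -> y <= y' -> x * y <= x' * y'.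
Proof.
move=> h1 h2; apply: le_trans (rmax_mul_le _ h2) _.
by rewrite ![_ * y']mulrC rmax_mul_le.
Qed.

Lemma rmax_mulE (a b : R) : (a%:mp : rmax R) * b%:mp = (a + b)%:mp. Proof. by []. Qed.

Lemma rmax_leE (a b : R) : ((a%:mp : rmax R) <= b%:mp) = (a <= b). Proof. by []. Qed.

Lemma rmax_expE (a : R) t : (a%:mp : rmax R) ^+ t = (a *+ t)%:mp.
Proof. by elim: t => // t IHt; rewrite exprS IHt rmax_mulE -mulrS. Qed.

Lemma rmax_neq0 x : x != 0 -> exists a, x = a%:mp.
Proof. by case: x => // a; exists a. Qed.

Lemma rmax_mul_neq0 x y : x * y != 0 -> x != 0 /\ y != 0.
Proof. by case: x y => [a|] [b|]. Qed.

End RmaxOrder.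

Section WalkMatrices.
Variables (R : realType) (d : nat) (u : 'I_d -> 'I_d -> R) (delta : 'I_d -> R).
Implicit Types (i j : 'I_d) (p : seq 'I_d) (e : rel 'I_d).

Definition walk_sum i p : R := \sum_(x <- walk_arcs i p) u x.1 x.2.

Lemma walk_sum_cons i x p : walk_sum i (x :: p) = u i x + walk_sum x p.
Proof. by rewrite /walk_sum walk_arcs_cons big_cons. Qed.

Lemma walk_sum_cat i p q : walk_sum i (p ++ q) = walk_sum i p + walk_sum (last i p) q.
Proof. by rewrite /walk_sum walk_arcs_cat big_cat. Qed.

(** A common form for [A], its normalization, [csrS A] and [B_HA A V]: reduced weights [u], a
    constant [c] per arc, and potentials that telescope along walks. *)
Definition walk_matrix e (c : R) (N : 'M[rmax R]_d) :=
  forall x y, N x y = if e x y then (u x y + c + delta x - delta y)%:mp else 0.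

(** With [walk_matrix_exp_attained]: an entry of a power is the largest weight of a walk of that
    length. *)
Lemma walk_matrix_exp_ge e c N i p : walk_matrix e c N -> path e i p ->
  (walk_sum i p + c *+ size p + delta i - delta (last i p))%:mp
    <= (N ^+ size p) i (last i p).
Proof.
move=> NP; elim: p i => [|x p IHp] i /=.
  by move=> _; rewrite expr0 /walk_sum big_nil mulr0n !add0r subrr -idmxE mxE eqxx.
move=> /andP[ix /IHp h]; rewrite exprS -mulmxE mxE.
apply: le_trans (rmax_le_sum _ (k := x) _) => //.
rewrite NP ix; apply: le_trans (rmax_mul_le _ h); rewrite rmax_mulE rmax_leE.
by rewrite walk_sum_cons mulrS; lra.
Qed.

Lemma walk_matrix_exp_attained e c N t i j : walk_matrix e c N -> (N ^+ t) i j != 0 ->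
  exists p, [/\ path e i p, last i p = j, size p = t &
    (N ^+ t) i j = (walk_sum i p + c *+ t + delta i - delta j)%:mp].
Proof.
move=> NP; elim: t i => [|t IHt] i.
  rewrite expr0 -idmxE mxE; case: (i =P j) => [<- _|]; last by rewrite eqxx.
  exists [::]; split=> //; rewrite /walk_sum big_nil mulr0n !add0r subrr //.
rewrite exprS -mulmxE mxE => h; have [x _ xE] := rmax_sum_attained h.
move: h; rewrite xE NP; case: ifP => [ix|_]; last by rewrite mul0r eqxx.
move=> /rmax_mul_neq0[_ /IHt[p [pP pl ps ->]]].
exists (x :: p); split=> //=; rewrite ?ix ?ps //.
by rewrite rmax_mulE walk_sum_cons mulrS; congr Some; lra.
Qed.

End WalkMatrices.

(** * Maximum cycle mean and reduced weights *)

Section CycleMean.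
Variables (R : realType) (d : nat) (A : 'M[rmax R]_d).
Hypothesis irrA : mp_irreducible A.
Let crit := critical_graph A.

Lemma arel_graph x y : arel (graph A) x y = (A x y != 0).
Proof. by rewrite /arel inE. Qed.

Lemma irreducible_arc : exists x y, arel (graph A) x y.
Proof.
case: (irrA) => d0 _ dA; have [A0|] := eqVneq A 0; last first.
  move=> A0; apply: contrapT => H; move/eqP: A0; apply.
  apply/matrixP => x y; rewrite mxE; apply/eqP/negPn/negP => xy; apply: H.
  by exists x, y; rewrite arel_graph.
case: d d0 A irrA dA A0 => [//|[|n]] d0 A' irr dA A0; first by case: dA.
have /connectP[[|y p] /=] :=
  graph_connect irr (@Ordinal n.+2 0 isT) (@Ordinal n.+2 1 isT).
  by move=> _ /(congr1 val).
by move=> /andP[xy _] _; exists ord0, y; move: xy;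
  rewrite (_ : Ordinal _ = ord0) //; apply: val_inj.
Qed.

Lemma exists_cycle : exists c, is_cycle (graph A) c.
Proof.
have [x [y xy]] := irreducible_arc.
have /connectP[p pP px] := graph_connect irrA y x.
have /closed_walk_cycles[[|c cs] csP E] : closed_walk (arel (graph A)) x (y :: p).
- by rewrite /closed_walk /= xy pP -px eqxx.
- by have := perm_walk_size E.
by exists c; exact: csP (mem_head _ _).
Qed.

(** Cycles have at most [d] nodes, so there are finitely many and [mcm] is a true maximum, not its
    default value. *)
Lemma mcm_maximum : (exists c, critical_cycle A c) /\
  forall c, is_cycle (graph A) c -> cycle_mean A c <= mcm A.
Proof.
have [c0 c0P] := exists_cycle.
have sz c : is_cycle (graph A) c -> (size c <= d)%N by move=> /size_cycle;
  rewrite ltnS.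
have P0 : is_cycle (graph A) (Bseq (sz _ c0P)) by [].
have [c cP cmax] := @Order.TotalTheory.arg_maxP _ R _ (Bseq (sz _ c0P))
  (fun b : d.-bseq 'I_d => is_cycle (graph A) b) (fun b => cycle_mean A b) P0.
have cub c' : is_cycle (graph A) c' -> cycle_mean A c' <= cycle_mean A c.
  by move=> c'P; exact: (cmax (Bseq (sz _ c'P))).
pose P := fun m : R => exists2 c, is_cycle (graph A) c & cycle_mean A c = m.
have [[c1 c1P c1E] ub] : P (mcm A) /\ ubound P (mcm A).
  apply: (xgetPex (0 : R) (P := fun x => P x /\ ubound P x)).
  by exists (cycle_mean A c); split=> [|_ [c' /cub + <-]] //; exists c.
split; first by exists c1.
by move=> c' c'P; apply: ub; exists c'.
Qed.

Section Potentials.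
Variables (u : 'I_d -> 'I_d -> R) (delta : 'I_d -> R).
Hypothesis uA : walk_matrix u delta (arel (graph A)) (mcm A) A.

Definition cycle_sum (c : seq 'I_d) : R := \sum_(x <- cycle_arcs c) u x.1 x.2.

(** The potential differences cancel around a cycle. *)
Lemma cycle_meanE c : is_cycle (graph A) c ->
  cycle_mean A c = cycle_sum c / (size c)%:R + mcm A.
Proof.
move=> /and3P[c0 uc cc].
have s0 : (size c)%:R != 0 :> R by rewrite pnatr_eq0 size_eq0.
apply: (mulIf s0); rewrite mulrDl !divfK //.
have -> : cycle_weight A c = \sum_(x <- cycle_arcs c)
    (u x.1 x.2 + mcm A + (delta x.1 - delta x.2)).
  rewrite /cycle_weight !big_seq;
    apply: eq_bigr => -[x y] /cycle_arcs_mem/andP[xc /eqP ->] /=.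
  by rewrite uA (next_cycle cc xc) /= addrA.
rewrite !big_split /= -addrA; congr (_ + _).
have -> : \sum_(x <- cycle_arcs c) mcm A = mcm A * (size c)%:R.
  by rewrite big_const_seq count_predT size_map iter_addr_0 mulr_natr.
rewrite -[RHS]addr0; congr (_ + _); rewrite sumrN; apply/eqP; rewrite subr_eq0;
  apply/eqP.
rewrite -(big_map snd predT delta) (perm_big _ (cycle_arcs_snd uc)) /=.
by rewrite /cycle_arcs big_map.
Qed.

Lemma cycle_sum_le0 c : is_cycle (graph A) c -> cycle_sum c <= 0.
Proof.
move=> cP; have := mcm_maximum.2 c cP; rewrite cycle_meanE // gerDr pmulr_lle0 //.
by rewrite invr_gt0 ltr0n lt0n size_eq0; case/and3P: cP.
Qed.

Lemma critical_cycle_sum c : critical_cycle A c -> cycle_sum c = 0.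
Proof.
move=> [cP]; rewrite cycle_meanE // -[RHS]add0r => /addIr/eqP.
rewrite mulf_eq0 invr_eq0 pnatr_eq0 size_eq0.
by case/and3P: cP => /negbTE -> _ _; rewrite orbF => /eqP.
Qed.

Lemma closed_walk_sum_le0 v q : closed_walk (arel (graph A)) v q ->
  walk_sum u v q <= 0.
Proof.
move=> /closed_walk_cycles[cs csP E]; rewrite /walk_sum (perm_big _ E) /=.
elim: cs csP {E} => [|c cs IHcs] csP; first by rewrite big_nil.
rewrite /= big_cat /= -[leRHS]addr0 lerD //.
  exact: cycle_sum_le0 (csP c (mem_head _ _)).
by apply: IHcs => x xs; apply: csP; rewrite inE xs orbT.
Qed.

End Potentials.
End CycleMean.

(** * Max-balanced scaling *)

Section Balancing.
Variables (R : realType) (d : nat) (A V : 'M[rmax R]_d) (delta : 'I_d -> R).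
Hypotheses (irrA : mp_irreducible A) (VA : V = diag_scaling delta A).
Hypothesis balV : max_balanced V.

Definition slack x y : R := rfin (V x y) - mcm A.

Lemma balancing_arc x y : arel (graph A) x y -> V x y = (slack x y + mcm A)%:mp.
Proof.
rewrite arel_graph /slack => /rmax_neq0[a aE]; rewrite subrK.
by rewrite VA mxE aE.
Qed.

Lemma balancing_walk_matrix : walk_matrix slack delta (arel (graph A)) (mcm A) A.
Proof.
move=> x y; case: ifP; rewrite arel_graph; last by move/negbFE/eqP.
move=> /rmax_neq0[a aE]; rewrite /slack VA mxE aE; congr Some => /=; lra.
Qed.

Lemma balancing_neq0 x y : (V x y != 0) = arel (graph A) x y.
Proof. by rewrite arel_graph VA mxE; case: (A x y). Qed.

(** Let [W] be the set reached from [y] by arcs of weight at least [m]. If [x] is outside, the arc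
    from [x] to [y] enters [W], so by balance an arc at least as heavy as [m] leaves [W], which is
    absurd. *)
Lemma balanced_return x y m : m%:mp <= V x y ->
  connect (fun v w => m%:mp <= V v w) y x.
Proof.
move=> mxy; pose T : rel 'I_d := fun v w => m%:mp <= V v w.
rewrite -/T; apply/negPn/negP => yx.
pose W := [set v | connect T y v].
have yW : y \in W by rewrite inE connect0.
have xW : x \in ~: W by rewrite !inE.
have : m%:mp <= \sum_(i in W) \sum_(j in ~: W) V i j.
  rewrite balV; apply: le_trans mxy _.
  apply: le_trans (rmax_le_sum _ xW); exact: (rmax_le_sum (fun j => V x j) yW).
move=> h; have [|v vW vE] :=
  @rmax_sum_attained _ _ (mem W) (fun i => \sum_(j in ~: W) V i j).
  by apply/eqP => E; rewrite E in h.
rewrite vE in h; have [|w wW wE] :=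
  @rmax_sum_attained _ _ (mem (~: W)) (fun j => V v j).
  by apply/eqP => E; rewrite E in h.
rewrite wE in h; move: wW vW; rewrite !inE => /negP wW vW; apply: wW.
by apply: connect_trans vW (connect1 _).
Qed.

(** The arc lies on a closed walk whose arcs are all at least as heavy; a positive slack would make
    the whole sum positive, against the maximality of the cycle mean. *)
Lemma slack_le0 x y : arel (graph A) x y -> slack x y <= 0.
Proof.
move=> xy; have := balanced_return (x := x) (y := y) (m := slack x y + mcm A).
rewrite -balancing_arc // => /(_ (lexx _))/connectP[p pP px].
have sub v w : V x y <= V v w ->
    arel (graph A) v w && (slack x y <= slack v w).
  move=> h; have vw : arel (graph A) v w.
    by rewrite -balancing_neq0; apply/eqP => E; move: h; rewrite E balancing_arc.
  by rewrite vw; move: h; rewrite !balancing_arc // rmax_leE lerD2r.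
have cl : closed_walk (arel (graph A)) x (y :: p).
  rewrite /closed_walk /= xy -px eqxx andbT /=.
  by apply: sub_path pP => v w /sub/andP[].
have := closed_walk_sum_le0 irrA balancing_walk_matrix cl.
apply: contraTT; rewrite -!ltNge => xy0.
rewrite walk_sum_cons ltr_pwDl // /walk_sum big_seq sumr_ge0 // => -[v w] vw.
have : path (fun v w => slack x y <= slack v w) y p.
  by apply: sub_path pP => v' w' /sub/andP[].
by rewrite path_walk_arcs => /allP/(_ _ vw) /= /(le_trans (ltW xy0)).
Qed.

(** Around a critical cycle, nonpositive slacks add up to 0. *)
Lemma slack_critical x y : arel (critical_graph A) x y -> slack x y = 0.
Proof.
move=> /critical_arcP[c cc xyc]; have [/and3P[_ _ cyc] _] := cc.
have cl x' y' : (x', y') \in cycle_arcs c -> slack x' y' <= 0.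
  by move=> /cycle_arcs_mem/andP[xc /eqP ->]; exact/slack_le0/next_cycle.
have := critical_cycle_sum balancing_walk_matrix cc.
rewrite /cycle_sum (perm_big _ (perm_to_rem xyc)) big_cons /= => E.
apply/eqP; rewrite eq_le cl //= -[leLHS]E gerDl big_seq.
elim/big_ind: _ => [|a b a0 b0|[x' y'] /mem_rem/cl //]; first by [].
by rewrite -[leRHS]addr0 lerD.
Qed.

End Balancing.

(** * CSR terms as weights of walks *)

Section ClosedWalkLengths.
Variable d : nat.
Implicit Types (G K : digraph d) (e : rel 'I_d).

Lemma detour e x y qy g L : connect e x y -> connect e y x -> closed_walk e y qy ->
    qy != [::] -> (0 < g)%N ->
  exists q, [/\ closed_walk e x q, (g %| size q)%N, (L <= size q)%N & y \in x :: q].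
Proof.
move=> /connectP[p1 p1P p1l] /connectP[p2 p2P p2l] /andP[qP ql] q0 g0.
pose q1 := p1 ++ qy ++ p2.
have cq : closed_walk e x q1.
  by rewrite /closed_walk !cat_path !last_cat -p1l (eqP ql) p1P qP p2P -p2l eqxx.
have s0 : (0 < size q1)%N by rewrite !size_cat; case: (qy) q0 => //= *;
  rewrite addnCA.
(* The round trip through [y] is nonempty thanks to [qy]; this many repetitions make its length a
   multiple of [g] and at least [L]. *)
exists (flatten (nseq (g * L.+1) q1)); split.
- exact: closed_walk_iter.
- by rewrite size_flatten_nseq -mulnA dvdn_mulr.
- rewrite size_flatten_nseq (leq_trans (leqnSn L)) // mulnAC leq_pmull //.
  by rewrite muln_gt0 g0.
- rewrite -(prednK (_ : 0 < g * L.+1)%N) ?muln_gt0 ?g0 //= -cat_cons mem_cat.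
  by rewrite -cat_cons mem_cat p1l mem_last.
Qed.

(** Modulo [g], the lengths of closed walks at [k] form a group. It contains the length of each
    cycle of [K], as the difference of two round trips, one with the cycle and one without, hence
    also their gcd. Negation is multiplication by [g.-1]. *)
Lemma scc_closed_lengths G K k g n : K \in sccs G -> k \in nodes K -> (0 < g)%N ->
  (scc_cyclicity K %| n)%N ->
  exists q, closed_walk (arel G) k q /\ size q = n %[mod g].
Proof.
move=> KS kK g0; pose P l :=
  exists q, closed_walk (arel G) k q /\ size q = l %[mod g].
have P0 : P 0%N by exists [::]; rewrite /closed_walk /= eqxx.
have PD a b : P a -> P b -> P (a + b)%N.
  move=> [q [qc qs]] [r [rc rs]]; exists (q ++ r); split;
    first exact: closed_walk_cat.
  by rewrite size_cat -modnDm qs rs modnDm.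
have PM a l : P l -> P (a * l)%N.
  by move=> Pl; elim: a => // a IHa; rewrite mulSn; exact: PD.
have Pcong a b : a = b %[mod g] -> P a -> P b by move=> ab [q [qc qs]]; exists q;
  rewrite qs.
have Pc c : is_cycle K c -> P (size c).
  move=> cK; have cn := scc_cycle_sub KS cK.
  have := scc_is_cycle KS cK => /and3P[c0 _ cyc].
  have [x xc] : exists x, x \in c by case: (c) c0 => // x s _; exists x;
    rewrite mem_head.
  have [r [rP rs _ _]] := cycle_closed_walk cyc xc; have /andP[rp rl] := rP.
  have /connectP[p1 p1P p1l] := scc_connect KS kK (cn _ xc).
  have /connectP[p2 p2P p2l] := scc_connect KS (cn _ xc) kK.
  have PA : P (size p1 + size p2)%N.
    exists (p1 ++ p2); split; last by rewrite size_cat.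
    by rewrite /closed_walk cat_path last_cat -p1l p1P p2P -p2l eqxx.
  have PB : P (size p1 + size p2 + size c)%N.
    exists (p1 ++ r ++ p2); split; last by rewrite !size_cat rs addnCA addnC addnAC.
    by rewrite /closed_walk !cat_path !last_cat -p1l (eqP rl) p1P rp p2P -p2l eqxx.
  apply: Pcong (PD _ _ (PM g.-1 _ PA) PB).
  by rewrite addnA -mulSnr prednK // mulnC modnMDl.
have Pg : P (scc_cyclicity K).
  apply: (big_ind P) => // [a b Pa Pb|l /asboolP[c cK <-]]; last exact: Pc.
  have [->|b0] := posnP a; first by rewrite gcd0n.
  have [x y E _] := egcdnP b b0.
  apply: Pcong (PD _ _ (PM x _ Pa) (PM (g.-1 * y)%N _ Pb)).
  rewrite E -addnA -addnCA -mulnA [X in (_ + X)%N](_ : _ = g * (y * b))%N; last first.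
    by rewrite -mulSn prednK.
  by rewrite addnC mulnC modnMDl.
by move=> /dvdnP[a ->]; exact: PM.
Qed.

End ClosedWalkLengths.

Section CSR.
Variables (R : realType) (d : nat) (A : 'M[rmax R]_d).
Variables (u : 'I_d -> 'I_d -> R) (delta : 'I_d -> R).
Let crit := critical_graph A.
Let sigma := cyclicity crit.
Let e := arel (graph A).
Hypothesis uA : walk_matrix u delta e (mcm A) A.
Hypothesis u_le0 : forall x y, e x y -> u x y <= 0.
Hypothesis u_crit : forall x y, arel crit x y -> u x y = 0.

Lemma critical_scc_cyclicity_gt0 K : K \in sccs crit -> (0 < scc_cyclicity K)%N.
Proof.
move=> /girth_cycleP[/[dup] /scc_cyclicity_dvd h /and3P[z0 _ _] _].
by apply: dvdn_gt0 h; rewrite lt0n size_eq0.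
Qed.

Lemma critical_cyclicity_gt0 : (0 < sigma)%N.
Proof.
rewrite /sigma /cyclicity; elim/big_ind: _ => // [a b a0 b0|K].
  by rewrite lcmn_gt0 a0.
exact: critical_scc_cyclicity_gt0.
Qed.

Lemma scc_cyclicity_dvd_critical K : K \in sccs crit -> (scc_cyclicity K %| sigma)%N.
Proof. by move=> KS; apply: (@biglcmn_sup _ K). Qed.

Lemma walk_sum_sub i p i' p' (s : seq ('I_d * 'I_d)) : path e i p ->
  perm_eq (walk_arcs i p) (walk_arcs i' p' ++ s) ->
    walk_sum u i p <= walk_sum u i' p'.
Proof.
move=> pP E; rewrite /walk_sum (perm_big _ E) big_cat /= gerDl.
have : all (fun x => e x.1 x.2) s by move: pP;
  rewrite (perm_walk_path _ E) all_cat => /andP[].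
elim: s {E} => [|x s IHs] /=; first by rewrite big_nil.
by move=> /andP[/u_le0 x0 /IHs s0]; rewrite big_cons -[leRHS]addr0 lerD.
Qed.

Lemma walk_sum_crit i p : path (arel crit) i p -> walk_sum u i p = 0.
Proof.
by elim: p i => [|x p IHp] i;
  rewrite /walk_sum ?big_nil // -/(walk_sum _ _ _) walk_sum_cons /= => /andP[/u_crit -> /IHp ->]; rewrite addr0.
Qed.

Let A' := (- mcm A)%:mp *: A.

Lemma normalized_walk_matrix : walk_matrix u delta e 0 A'.
Proof.
move=> x y; rewrite mxE uA; case: ifP => // _.
by rewrite rmax_mulE; congr Some; lra.
Qed.

Lemma csrS_walk_matrix : walk_matrix u delta (arel crit) 0 (csrS A).
Proof.
move=> x y; rewrite mxE; case: ifP => // /critical_sub xy.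
by rewrite uA [e x y]xy rmax_mulE; congr Some; lra.
Qed.

(** A walk of length at least [n * d] visits some node more than [n] times, twice at times congruent
    modulo [n]; cutting between them removes only nonpositive weights. *)
Lemma shorten_walk n i p : (0 < n)%N -> path e i p -> (n %| size p)%N ->
  exists q, [/\ path e i q, last i q = last i p, (n %| size q)%N,
    (size q < n * d)%N & walk_sum u i p <= walk_sum u i q].
Proof.
move=> n0; have [k] := ubnP (size p); elim: k p => // k IHk p /ltnSE pk pP pn.
have [ps|ps] := ltnP (size p) (n * d); first by exists p.
have [v vn] : exists v, (n < count_mem v (i :: p))%N.
  apply: contrapT => H; suff : (size (i :: p) <= n * d)%N by rewrite /= ltnNge ps.
  rewrite -(count_predT (i :: p)) count_sum_mem -[d in (n * d)%N]card_ord mulnC -sum_nat_const.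
  by apply: leq_sum => v _; rewrite leqNgt; apply/negP => h; apply: H; exists v.
have pot : potential 1 (fun=> 0%N) e by move=> x y _; rewrite !modn1.
have [u1 [u2 [u3 [pE ul un un']]]] := frequent_node_loop (ltnSn 0) n0 pot pP vn.
rewrite mul1n in un'.
have /and3P[P1 P2 P3] : [&& path e i u1, path e (last i u1) u2 & path e (last i u1) u3].
  by move: pP; rewrite pE !cat_path ul.
have u20 : (0 < size u2)%N by case: (u2) un.
have sz : (size p = size (u1 ++ u3) + size u2)%N by rewrite pE !size_cat; lia.
have [|||q [qP ql qn qs qu]] := IHk (u1 ++ u3).
- by rewrite (leq_trans _ pk) // sz -addn1 leq_add2l.
- by rewrite cat_path P1.
- by move: pn; rewrite sz dvdn_addl.
exists q; split=> //; first by rewrite ql pE !last_cat ul.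
apply: le_trans qu; apply: (walk_sum_sub (s := walk_arcs (last i u1) u2) pP).
rewrite pE !walk_arcs_cat ul -catA perm_cat2l perm_catC //.
Qed.

Lemma csrM_powE k i j : ((A' ^+ sigma) ^+ k) i j = (A' ^+ (sigma * k)) i j.
Proof. by rewrite exprM. Qed.

(** By [shorten_walk] the exponents [k <= d] dominate all the others, so the supremum in the Kleene
    star is a maximum. *)
Lemma csrM_attained i j : (exists k, csrM A i j = (A' ^+ (sigma * k)) i j) /\
  forall k, (A' ^+ (sigma * k)) i j <= csrM A i j.
Proof.
pose F k := (A' ^+ (sigma * k)) i j.
have [k0 _ k0max] :=
  @Order.TotalTheory.arg_maxP _ (rmax R) 'I_d.+1 ord0 predT (fun k => F k) isT.
have {}k0max k : F k <= F k0.
  have [/eqP F0|Fk0] := boolP (F k == 0); first by rewrite F0.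
  have [p [pP pl ps pE]] := walk_matrix_exp_attained normalized_walk_matrix Fk0.
  rewrite [F k]pE.
  have [|q [qP ql qn qs qu]] := shorten_walk critical_cyclicity_gt0 pP.
    by rewrite ps dvdn_mulr.
  have kq : (size q %/ sigma < d.+1)%N.
    by rewrite ltnS ltnW // ltn_divLR ?critical_cyclicity_gt0 // mulnC.
  apply: le_trans (k0max (Ordinal kq) isT).
  have := walk_matrix_exp_ge normalized_walk_matrix qP.
  rewrite /F /= [(sigma * (size q %/ _))%N]mulnC divnK // ql pl; apply: le_trans.
  by rewrite rmax_leE !mul0rn !addr0 !lerD2r.
have E : csrM A i j = F k0.
  rewrite /csrM mxE /supremum; case: ifPn => [/eqP S0|_].
    have : set0 (F k0) by rewrite -S0; exists k0; rewrite csrM_powE.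
    by [].
  apply: xget_subset1; last exact: is_subset1_supremums.
  split=> [_ [k <-]|w]; first by rewrite csrM_powE; exact: k0max.
  by apply; exists k0; rewrite csrM_powE.
by split=> [|k]; [exists k0|rewrite E; exact: k0max].
Qed.

Lemma csrM_ge i p : path e i p -> (sigma %| size p)%N ->
  (walk_sum u i p + delta i - delta (last i p))%:mp <= csrM A i (last i p).
Proof.
move=> pP /dvdnP[k ps]; have [_ /(_ k)] := csrM_attained i (last i p).
rewrite mulnC -ps; apply: le_trans.
by have := walk_matrix_exp_ge normalized_walk_matrix pP; rewrite mul0rn addr0.
Qed.

Lemma csrM_walk i j : csrM A i j != 0 -> exists p, [/\ path e i p, last i p = j,
  (sigma %| size p)%N & csrM A i j = (walk_sum u i p + delta i - delta j)%:mp].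
Proof.
have [[k ->] _] := csrM_attained i j.
move=> /(walk_matrix_exp_attained normalized_walk_matrix)[p [pP pl ps ->]].
by exists p; split=> //; rewrite ?ps ?dvdn_mulr // mul0rn addr0.
Qed.

Definition csr t := csrC A *m csrS A ^+ t *m csrR A.

(** With [csr_walk]: a CSR entry is the largest weight of a walk in three pieces, the outer ones of
    length divisible by [sigma], the middle one critical, of length [t] and reduced weight 0. *)
Lemma csr_ge i k p1 p2 p3 : path e i p1 -> last i p1 = k -> (sigma %| size p1)%N ->
    path (arel crit) k p2 -> k \in nodes crit ->
    path e (last k p2) p3 -> (sigma %| size p3)%N ->
  (walk_sum u i p1 + walk_sum u (last k p2) p3 + delta i - delta (last (last k p2) p3))%:mp
    <= csr (size p2) i (last (last k p2) p3).
Proof.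
move=> p1P p1l p1s p2P kc p3P p3s; set l := last k p2 in p3P *; set j := last l p3.
have lc : l \in nodes crit.
  rewrite /l; case/lastP: (p2) p2P => // p x;
    rewrite rcons_path last_rcons => /andP[_].
  by move=> /critical_wf[].
rewrite /csr mxE; apply: le_trans (rmax_le_sum _ (k := l) _) => //.
apply: (@le_trans _ _ ((walk_sum u i p1 + delta i - delta l)%:mp *
   (walk_sum u l p3 + delta l - delta j)%:mp)).
  by rewrite rmax_mulE rmax_leE; lra.
apply: rmax_mul_le2; last by rewrite mxE lc; exact: csrM_ge.
rewrite mxE; apply: le_trans (rmax_le_sum _ (k := k) _) => //.
apply: (@le_trans _ _ ((walk_sum u i p1 + delta i - delta k)%:mp * (delta k - delta l)%:mp)).
  by rewrite rmax_mulE rmax_leE; lra.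
apply: rmax_mul_le2; first by rewrite mxE kc -p1l; exact: csrM_ge.
have := walk_matrix_exp_ge csrS_walk_matrix p2P.
by rewrite walk_sum_crit // mul0rn !add0r.
Qed.

Lemma csr_walk t i j : csr t i j != 0 -> exists k p1 p2 p3,
  [/\ path e i p1, last i p1 = k & (sigma %| size p1)%N] /\
  [/\ path (arel crit) k p2, k \in nodes crit & size p2 = t] /\
  [/\ path e (last k p2) p3, last (last k p2) p3 = j, (sigma %| size p3)%N &
  csr t i j = (walk_sum u i p1 + walk_sum u (last k p2) p3 + delta i - delta j)%:mp].
Proof.
rewrite /csr mxE => h; have [l _ lE] := rmax_sum_attained h.
move: h; rewrite lE => /rmax_mul_neq0[h1 h2].
rewrite mxE in h1; rewrite mxE; have [k _ kE] := rmax_sum_attained h1.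
move: h1; rewrite kE => /rmax_mul_neq0[h0 h1].
move: h0 h2; rewrite ![csrC _ _ _]mxE ![csrR _ _ _]mxE.
case: ifP => [kc h0|]; last by rewrite eqxx.
case: ifP => [lc h2|]; last by rewrite eqxx.
have [p1 [p1P p1l p1s ->]] := csrM_walk h0.
have [p3 [p3P p3l p3s ->]] := csrM_walk h2.
have [p2 [p2P p2l p2s ->]] := walk_matrix_exp_attained csrS_walk_matrix h1.
exists k, p1, p2, p3; rewrite p2l; do !split=> //.
by rewrite !rmax_mulE (walk_sum_crit p2P) mul0rn; congr Some; lra.
Qed.

Lemma csr_ge_cycle t z i p : is_cycle crit z -> path e i p -> has (mem z) (i :: p) ->
  size p = t %[mod size z] ->
  (walk_sum u i p + delta i - delta (last i p))%:mp <= csr t i (last i p).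
Proof.
move=> /and3P[z0 uz cz] pP /(has_nthP i)[s]; rewrite ltnS => sp.
rewrite nth_last_take // => xz pt; set x := last i _ in xz.
have [q [qc qs _ _]] := cycle_closed_walk cz xz.
have g0 : (0 < size z)%N by rewrite lt0n size_eq0.
move: pP pt; rewrite -(cat_take_drop s p) cat_path last_cat walk_sum_cat -/x.
move: (take s p) (drop s p) @x xz qc => p1 p2 x xz qc /andP[p1P p2P] pt.
have L0 : (0 < sigma * size z)%N by rewrite muln_gt0 critical_cyclicity_gt0.
(* Turns around [z] weigh nothing. Cut into pieces of lengths [al], [t] and [be], they complete the
   two halves of [p] to multiples of [sigma] and supply the middle piece; the congruence of lengths
   makes [al + t + be] a whole number of turns. *)
pose al := (size p1 * (sigma * size z).-1)%N; pose be :=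
  (size p2 * (sigma * size z).-1)%N.
have aE : (al + size p1 = size p1 * (sigma * size z))%N by rewrite /al -mulnSr prednK.
have bE : (be + size p2 = size p2 * (sigma * size z))%N by rewrite /be -mulnSr prednK.
have [n nE] : exists n, (al + t + be = n * size z)%N.
  apply/dvdnP; rewrite /dvdn -[X in _ == X](mod0n (size z)) -(eqn_modDr (size p1 + size p2)) add0n.
  have -> : (al + t + be + (size p1 + size p2) = (al + size p1) + (be + size p2) + t)%N by lia.
  by rewrite aE bE !mulnA -mulnDl modnMDl -pt size_cat.
have := closed_walk_iter n qc; set Q := flatten _ => /andP[QP /eqP Ql].
have Qs : size Q = (al + (t + be))%N by rewrite size_flatten_nseq qs -nE addnA.
pose Q1 := take al Q; pose Q2 := take t (drop al Q); pose Q3 := drop t (drop al Q).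
have QE : Q = Q1 ++ Q2 ++ Q3 by rewrite !cat_take_drop.
have Q1s : size Q1 = al by rewrite size_takel // Qs leq_addr.
have Q2s : size Q2 = t by rewrite size_takel // size_drop Qs addKn leq_addr.
have Q3s : size Q3 = be by rewrite !size_drop Qs !addKn.
move: QP Ql; rewrite QE !cat_path !last_cat => /and3P[Q1P Q2P Q3P] Ql.
have subp y r : path (arel crit) y r -> path e y r by apply: sub_path;
  exact: critical_sub.
have := @csr_ge i (last x Q1) (p1 ++ Q1) Q2 (Q3 ++ p2).
rewrite Q2s !last_cat !walk_sum_cat Ql -/x (walk_sum_crit Q1P) (walk_sum_crit Q3P) addr0 add0r; apply.
- by rewrite cat_path p1P subp.
- by [].
- by rewrite size_cat Q1s addnC aE mulnCA dvdn_mulr.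
- by [].
- have : path (arel crit) x Q1 := Q1P; case/lastP: (Q1) => [_|r y].
    by have /critical_wf[] := next_cycle cz xz.
  by rewrite rcons_path last_rcons => /andP[_ /critical_wf[]].
- by rewrite cat_path subp // Ql.
- by rewrite size_cat Q3s bE mulnCA dvdn_mulr.
Qed.

End CSR.

Lemma congr_le g a t : a = t %[mod g] -> (a < t + g)%N -> (a <= t)%N.
Proof.
move=> /eqP E h; rewrite leqNgt; apply/negP => ta; move: E.
rewrite eqn_mod_dvd ?(ltnW ta) // => dv; have := dvdn_leq _ dv.
by rewrite subn_gt0 => /(_ ta); lia.
Qed.

(** * Comparison of powers with CSR terms *)

Section CSRExpansion.
Variables (R : realType) (d : nat) (A : 'M[rmax R]_d).
Variables (u : 'I_d -> 'I_d -> R) (delta : 'I_d -> R).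
Let crit := critical_graph A.
Let e := arel (graph A).
Hypothesis irrA : mp_irreducible A.
Hypothesis uA : walk_matrix u delta e (mcm A) A.
Hypothesis u_le0 : forall x y, e x y -> u x y <= 0.
Hypothesis u_crit : forall x y, arel crit x y -> u x y = 0.

(** Thresholds exist by [tcr_threshold_general], so [Tcr] is one of them. *)
Lemma Tcr_threshold K : K \in sccs crit ->
  tcr_threshold (girth K) A (cycle_digraph (girth_cycle K))
    (Tcr (girth K) A (cycle_digraph (girth_cycle K))).
Proof.
move=> KS; apply: (leastP (P := tcr_threshold _ _ _) _).1.
have zP := girth_cycle_graph KS; have [f fP] := graph_potential irrA.
have [_ <-] := girth_cycleP KS; eexists.
exact: tcr_threshold_general zP (cyclicity_gt0 zP) fP.
Qed.

Lemma girth_gt0 K : K \in sccs crit -> (0 < girth K)%N.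
Proof.
move=> KS; have [_ <-] := girth_cycleP KS.
by rewrite lt0n size_eq0 (girth_cycle_neq0 KS).
Qed.

Lemma cycle_reduction K t i p : K \in sccs crit -> (removal_penalty A K <= t)%N ->
    path e i p -> has (mem (girth_cycle K)) (i :: p) ->
    (Tcr (girth K) A (cycle_digraph (girth_cycle K)) <= size p)%N ->
    size p = t %[mod girth K] ->
  exists q rest s ins, [/\ [/\ path e i q, last i q = last i p,
      has (mem (girth_cycle K)) (i :: q), size q = t %[mod girth K] & (size q <= t)%N],
    perm_eq (walk_arcs i p) (rest ++ s), perm_eq (walk_arcs i q) (rest ++ ins) &
    forall x, x \in ins -> u x.1 x.2 = 0].
Proof.
move=> KS pen pP pz ps pt; rewrite -via_cycle_digraph in pz.
have [q [[qP ql] qz [rest [rem [ins [_ insP pE qE]]]] qs qT]] :=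
  Tcr_threshold KS pP pz ps.
have qt : size q = t %[mod girth K] by rewrite qs.
exists q, rest, (flatten (map (@cycle_arcs d) rem)),
  (flatten (map (@cycle_arcs d) ins)).
split=> //.
  split=> //; first by rewrite -via_cycle_digraph.
  (* The penalty bound gives [size q < t + girth K], which the congruence improves to
     [size q <= t]. *)
  apply: congr_le qt _; move: pen; rewrite /removal_penalty leq_subLR addn1 addnC.
  exact: leq_ltn_trans.
move=> [x y] /flatten_mapP[c /(allP insP)/and3P[_ _ cc] /cycle_arcs_mem/andP[xc /eqP -> /=]].
have := next_cycle cc xc; rewrite arel_cycle_digraph => /andP[xz /eqP ->];
  apply: u_crit.
by have /and3P[_ _ /next_cycle] := girth_cycle_crit KS; apply.
Qed.

Lemma girth_cycle_head K : K \in sccs crit -> exists y qy, [/\ y \in girth_cycle K,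
  closed_walk (arel crit) y qy, qy != [::] & size qy = girth K].
Proof.
move=> KS; have := girth_cycle_neq0 KS; case zE: (girth_cycle K) => [//|y s] _.
have yz : y \in girth_cycle K by rewrite zE mem_head.
have /and3P[_ _ cz] := girth_cycle_crit KS; have [_ gE] := girth_cycleP KS.
have [q [qc qs _ _]] := cycle_closed_walk cz yz.
exists y, q; rewrite -gE -qs; split=> //; first by rewrite -zE.
by rewrite -size_eq0 qs zE.
Qed.

Lemma walk_sum_perm i p s : perm_eq (walk_arcs i p) s ->
  walk_sum u i p = \sum_(x <- s) u x.1 x.2.
Proof. by move=> E; rewrite /walk_sum (perm_big _ E). Qed.

Lemma sum_ins0 (ins : seq ('I_d * 'I_d)) : (forall x, x \in ins -> u x.1 x.2 = 0) ->
  \sum_(x <- ins) u x.1 x.2 = 0.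
Proof. by move=> h; rewrite big_seq big1. Qed.

Lemma crit_path i p : path (arel crit) i p -> path e i p.
Proof. by apply: sub_path; exact: critical_sub. Qed.

(** The three pieces of a CSR walk are too long for the exponent [t]. Critical closed walks inserted
    at [k] fix the length modulo the girth and lead through the girth cycle; the walk is then
    reduced to length at most [t] and filled up to [t] with turns around that cycle. *)
Lemma csr_le_pow t i j : (forall K, K \in sccs crit ->
  (removal_penalty A K <= t)%N) ->
  (mcm A)%:mp ^+ t * csr A t i j <= (A ^+ t) i j.
Proof.
move=> pen; have [->|h] := eqVneq (csr A t i j) 0; first by rewrite mulr0.
have [k [p1 [p2 [p3 [[p1P p1l p1s] [[p2P kc p2s] [p3P p3l p3s ->]]]]]]] :=
  csr_walk uA u_le0 u_crit h.
set K := component crit k; have KS : K \in sccs crit by exact: scc_in.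
have kK : k \in nodes K by exact: component_refl.
have g0 := girth_gt0 KS.
have [y [qy [yz qyc qy0 qys]]] := girth_cycle_head KS.
have yK := girth_cycle_nodes KS yz.
have [q1 [q1c q1g q1T q1y]] :=
  detour (Tcr (girth K) A (cycle_digraph (girth_cycle K)))
  (scc_connect KS kK yK) (scc_connect KS yK kK) qyc qy0 g0.
(* Modulo the girth, [q0] cancels the lengths of the outer pieces, which are divisible by
   [sigma]. *)
have [|q0 [q0c q0s]] := @scc_closed_lengths d _ K k (girth K)
  ((girth K).-1 * (size p1 + size p3)) KS kK g0.
  rewrite dvdn_mull // dvdn_add // (dvdn_trans (scc_cyclicity_dvd_critical KS)) //.
have [/andP[q0P /eqP q0l] /andP[q1P /eqP q1l]] := (q0c, q1c).
pose W := p1 ++ q0 ++ q1 ++ p2 ++ p3.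
have WP : path e i W.
  by rewrite !cat_path p1P p1l crit_path // q0l crit_path // q1l (crit_path p2P).
have Wl : last i W = j by rewrite !last_cat p1l q0l q1l.
have Wsum : walk_sum u i W = walk_sum u i p1 + walk_sum u (last k p2) p3.
  rewrite !walk_sum_cat p1l q0l q1l (walk_sum_crit u_crit q0P) (walk_sum_crit u_crit q1P).
  by rewrite (walk_sum_crit u_crit p2P) !add0r.
have Ws : size W = t %[mod girth K].
  rewrite !size_cat p2s.
  have -> (a b c n m : nat) : (a + (b + (c + (n + m))) = c + (b + (a + m) + n))%N.
    by clear; lia.
  have q0g : ((size q0 + (size p1 + size p3)) %% girth K = 0)%N.
    by rewrite -modnDml q0s modnDml -mulSnr prednK // modnMr.
  by rewrite -modnDml (eqP q1g) add0n -modnDml q0g.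
have Wz : has (mem (girth_cycle K)) (i :: W).
  apply/hasP; exists y => //; move: q1y; rewrite -q0l => q1y.
  have : y \in last i (p1 ++ q0) :: q1 by rewrite last_cat p1l.
  rewrite /W catA -cat_cons inE => /orP[/eqP ->|yq1]; rewrite mem_cat.
    by rewrite mem_last.
  by rewrite [y \in q1 ++ _]mem_cat yq1 orbT.
have WT : (Tcr (girth K) A (cycle_digraph (girth_cycle K)) <= size W)%N.
  by rewrite !size_cat; apply: leq_trans q1T _; clear; lia.
have [q [rest [s [ins [[qP ql qz qs qt] WE qE ins0]]]]] :=
  cycle_reduction KS (pen K KS) WP Wz WT Ws.
have /hasP[w wq wz] := qz.
have [w' [qw [qwc qws]]] :
  exists w' qw, closed_walk (arel crit) w' qw /\ (size qw = girth K /\ w' = w).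
  have /and3P[_ _ cz] := girth_cycle_crit KS; have [_ gE] := girth_cycleP KS.
  by have [r [rc rs _ _]] := cycle_closed_walk cz wz; exists w, r; rewrite rs.
move: qws => [qws wE]; rewrite wE in qwc.
have [n nE] : exists n, (t - size q = n * girth K)%N.
  by apply/dvdnP; rewrite -eqn_mod_dvd // eq_sym; apply/eqP.
have /andP[qnP qnl] := closed_walk_iter n qwc.
have qnc : closed_walk e w (flatten (nseq n qw)) by rewrite /closed_walk crit_path.
have [r [rP rl rE]] := splice qP qnc wq (mem_head _ _).
have rs : size r = t.
  by rewrite (perm_walk_size rE) size_cat !size_walk_arcs size_flatten_nseq qws -nE subnKC.
have rsum : walk_sum u i W <= walk_sum u i r.
  rewrite (walk_sum_perm rE) big_cat /= -/(walk_sum u w _) (walk_sum_crit u_crit qnP) addr0.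
  rewrite -/(walk_sum u i q) (walk_sum_perm qE) big_cat /= (sum_ins0 ins0) addr0.
  rewrite (walk_sum_perm WE) big_cat /= gerDl.
  have : all (fun x => e x.1 x.2) s by move: WP;
    rewrite (perm_walk_path _ WE) all_cat => /andP[].
  move=> /allP sP; rewrite big_seq; elim/big_ind: _ => // [a b a0 b0|x /sP/u_le0//].
  by rewrite -[leRHS]addr0 lerD.
have := walk_matrix_exp_ge uA rP; rewrite rl ql Wl rs; apply: le_trans.
by rewrite rmax_expE rmax_mulE rmax_leE; move: rsum; rewrite Wsum; lra.
Qed.

(* Forced through [z] by a detour whose arcs are at least as heavy as those of
   the walk, a reduction of the walk trades its arcs for heavier ones. *)
Lemma detour_domination K t i p x y mu (T : rel 'I_d) :
    K \in sccs crit -> (removal_penalty A K <= t)%N -> path e i p -> size p = t ->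
    mu <= 0 -> (forall a, a \in walk_arcs i p -> u a.1 a.2 <= mu) ->
    (forall v w, T v w -> e v w && (mu <= u v w)) -> (forall v w, arel crit v w ->
      T v w) ->
    x \in i :: p -> y \in girth_cycle K -> connect T x y -> connect T y x ->
  (walk_sum u i p + delta i - delta (last i p))%:mp <= csr A t i (last i p).
Proof.
move=> KS pen pP ps mu0 pmu Te cT xp yz xy yx.
have g0 := girth_gt0 KS; have [_ gE] := girth_cycleP KS.
have /and3P[z0 _ cz] := girth_cycle_crit KS.
have [qy [qyc qys _ _]] := cycle_closed_walk cz yz.
have {}qyc : closed_walk T y qy.
  by case/andP: qyc => h hl; apply/andP; split=> //; exact: sub_path h.
have qy0 : qy != [::] by rewrite -size_eq0 qys gE -lt0n.
have [q1 [q1c q1g q1T q1y]] :=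
  detour (Tcr (girth K) A (cycle_digraph (girth_cycle K)))
  xy yx qyc qy0 g0.
have /andP[q1P q1l] := q1c.
have q1e : closed_walk e x q1.
  by rewrite /closed_walk q1l andbT; apply: sub_path q1P => v w /Te/andP[].
have [r [rP rl rE]] := splice pP q1e xp (mem_head _ _).
have rs : size r = (size p + size q1)%N by rewrite (perm_walk_size rE) size_cat !size_walk_arcs.
have rz : has (mem (girth_cycle K)) (i :: r).
  apply/hasP; exists y => //; move: q1y; rewrite inE => /orP[/eqP ->|yq1].
    exact: (splice_nodes rE).
  by apply: (splice_loop_nodes rE); rewrite walk_arcs_snd.
have [||q [rest [s [ins [[qP ql qz qs qt] rE' qE ins0]]]]] :=
  cycle_reduction KS pen rP rz.
- by rewrite rs (leq_trans q1T) // leq_addl.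
- by rewrite rs ps -modnDmr (eqP q1g) addn0.
have qsum : walk_sum u i p <= walk_sum u i q.
  (* The excess over [mu], truncated at 0: it equals [u - mu] on the walk, vanishes on the detour,
     and is nonpositive, so its sum does not decrease when arcs are removed. *)
  pose w (a : 'I_d * 'I_d) := Num.min (u a.1 a.2 - mu) 0.
  have w0 (l : seq ('I_d * 'I_d)) : \sum_(a <- l) w a <= 0.
    elim/big_ind: _ => // [a b a0 b0|a _]; first by rewrite -[leRHS]addr0 lerD.
    by rewrite /w ge_min lexx orbT.
  have wsub (l : seq ('I_d * 'I_d)) : \sum_(a <- l) w a <= \sum_(a <- l) u a.1 a.2 - mu *+ size l.
    elim: l => [|a l IHl]; first by rewrite !big_nil mulr0n subrr.
    rewrite !big_cons mulrS opprD addrACA lerD //.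
    by rewrite /w ge_min lexx.
  have wp : \sum_(a <- walk_arcs i p) w a = walk_sum u i p - mu *+ t.
    rewrite -ps -(size_walk_arcs i p) /walk_sum.
    elim: (walk_arcs i p) pmu => [|a l IHl] pmu;
      first by rewrite !big_nil mulr0n subrr.
    rewrite !big_cons mulrS opprD addrACA IHl; last first.
      by move=> b bl; apply: pmu; rewrite inE bl orbT.
    by congr (_ + _); rewrite /w min_l // subr_le0 pmu ?mem_head.
  have wq : \sum_(a <- walk_arcs x q1) w a = 0.
    rewrite big_seq big1 // => a aq; rewrite /w min_r // subr_ge0.
    by move: q1P; rewrite path_walk_arcs => /allP/(_ _ aq)/Te/andP[].
  have E : \sum_(a <- rest) w a + \sum_(a <- s) w a = walk_sum u i p - mu *+ t.
    by rewrite -big_cat -(perm_big _ rE') (perm_big _ rE) big_cat /= wp wq addr0.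
  have rest_t : (size rest <= t)%N.
    by apply: leq_trans qt; rewrite (perm_walk_size qE) size_cat leq_addr.
  (* As [mu <= 0], keeping fewer than [t] arcs can only help. *)
  have mu_t : mu *+ t <= mu *+ size rest.
    by rewrite -(subnKC rest_t) mulrnDr gerDl mulrn_wle0.
  rewrite (walk_sum_perm qE) big_cat /= (sum_ins0 ins0) addr0.
  by have := wsub rest; have := w0 s; lra.
rewrite -rl -ql; apply: le_trans (csr_ge_cycle uA u_le0 u_crit (girth_cycle_crit KS) qP qz _).
  by rewrite rmax_leE !lerD2r.
by rewrite gE.
Qed.

End CSRExpansion.

(** * The Hartmann-Arguelles scheme *)

Section HartmannArguelles.
Variables (R : realType) (d : nat) (A V : 'M[rmax R]_d) (delta : 'I_d -> R).
Let crit := critical_graph A.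
Let e := arel (graph A).
Hypotheses (irrA : mp_irreducible A) (VA : V = diag_scaling delta A).
Hypothesis balV : max_balanced V.
Let u := slack A V.
Let uA : walk_matrix u delta e (mcm A) A := balancing_walk_matrix VA.
Let u_le0 : forall x y, e x y -> u x y <= 0 := slack_le0 irrA VA balV.
Let u_crit : forall x y, arel crit x y -> u x y = 0 := slack_critical irrA VA balV.

Lemma arel_Tha mu x y : arel (Tha A V mu) x y = e x y && (mu <= V x y).
Proof. by rewrite /arel inE. Qed.

Lemma Tha_node mu x : x \in nodes (Tha A V mu) -> exists v w, e v w /\ mu <= V v w.
Proof.
by rewrite inE => /orP[] /imsetP[[v w] + _]; rewrite inE => /andP[vw h]; exists v, w.
Qed.

Let bad (mu : rmax R) := mu <= (mcm A)%:mp /\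
  exists2 H, H \in sccs (Tha A V mu) &
    forall K, K \in sccs crit -> ~~ subgraph K H.

(** Raising [mu] to the least arc weight above it leaves the digraph unchanged, so finitely many
    thresholds matter and [mu_ha] is attained. *)
Lemma Tha_threshold mu : bad mu -> exists x y, [/\ e x y, bad (V x y) & mu <= V x y].
Proof.
move=> [mul [H HS HK]].
have [v0 [w0 [vw0 mu0]]] : exists v w, e v w /\ mu <= V v w.
  by move: HS => /imsetP[i /Tha_node].
have P0 : e (v0, w0).1 (v0, w0).2 && (mu <= V (v0, w0).1 (v0, w0).2) by rewrite vw0.
have [[v w] /andP[vw muv] vwmin] := @Order.TotalTheory.arg_minP _ (rmax R) _ (v0, w0)
  (fun a : 'I_d * 'I_d => e a.1 a.2 && (mu <= V a.1 a.2)) (fun a => V a.1 a.2) P0.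
exists v, w; split=> //; split.
  by rewrite (balancing_arc VA) // rmax_leE gerDr u_le0.
suff -> : Tha A V (V v w) = Tha A V mu by exists H.
rewrite /Tha; congr induced_by_arcs; apply/setP => -[x y]; rewrite !inE /=.
case xy: (A x y != 0) => //=; apply/idP/idP => [|h]; first exact: le_trans muv.
by apply: (vwmin (x, y)); rewrite /= h andbT /e arel_graph.
Qed.

Lemma mu_ha_spec : mu_ha A V <= (mcm A)%:mp /\
  forall x y, e x y -> mu_ha A V < V x y -> forall H, H \in sccs (Tha A V (V x y)) ->
    exists2 K, K \in sccs crit & subgraph K H.
Proof.
have ge x y : e x y -> ~ bad (V x y) -> forall H, H \in sccs (Tha A V (V x y)) ->
    exists2 K, K \in sccs crit & subgraph K H.
  move=> xy nb H HS; apply: contrapT => nK; apply: nb; split.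
    by rewrite (balancing_arc VA) // rmax_leE gerDr u_le0.
  by exists H => // K KS; apply/negP => KH; apply: nK; exists K.
have [[mu mub]|nobad] := pselect (exists mu, bad mu); last first.
  (* The default value is -oo, as the definition of the scheme requires. *)
  have E : mu_ha A V = 0 by apply: xgetPN => mu [mub _]; apply: nobad; exists mu.
  split; first by rewrite E.
  by move=> x y xy _; apply: ge xy _ => b; apply: nobad; exists (V x y).
have [v0 [w0 [vw0 b0 _]]] := Tha_threshold mub.
have P0 : e (v0, w0).1 (v0, w0).2 && `[< bad (V (v0, w0).1 (v0, w0).2) >].
  by rewrite vw0; apply/asboolP.
have [[v w] /andP[vw /asboolP vwb] vwmax] :=
  @Order.TotalTheory.arg_maxP _ (rmax R) _ (v0, w0)
  (fun a : 'I_d * 'I_d => e a.1 a.2 && `[< bad (V a.1 a.2) >]) (fun a => V a.1 a.2) P0.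
have [[mul _] ub] : bad (mu_ha A V) /\ ubound bad (mu_ha A V).
  apply: (xgetPex (0 : rmax R) (P := fun x => bad x /\ ubound bad x)).
  exists (V v w); split=> // mu' /Tha_threshold[x [y [xy xyb h]]].
  apply: le_trans h _; apply: (vwmax (x, y)); rewrite /= xy; exact/asboolP.
split=> // x y xy lt; apply: ge xy _ => /ub.
by rewrite leNgt lt.
Qed.

Lemma Gha_walk_domination t i p : (forall K, K \in sccs crit ->
  (removal_penalty A K <= t)%N) ->
    path e i p -> size p = t -> has (mem (Gha_nodes A V)) (i :: p) ->
  (walk_sum u i p + delta i - delta (last i p))%:mp <= csr A t i (last i p).
Proof.
move=> pen pP ps pG; have [mul muH] := mu_ha_spec.
have arc v w : (v, w) \in walk_arcs i p -> e v w.
  by move: pP; rewrite path_walk_arcs => /allP h /h.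
have [/hasP[[v0 w0] vw0 /= lt0]|/hasPn small] :=
  boolP (has (fun a => mu_ha A V < V a.1 a.2) (walk_arcs i p)).
  (* The heaviest arc of the walk lies above [mu_ha]: its component at the level of its own weight
     contains a critical component, hence a detour by arcs at least as heavy. *)
  have [[v w] vw vwmax] := @Order.TotalTheory.arg_maxP _ (rmax R) _ (v0, w0)
    (fun a => a \in walk_arcs i p) (fun a => V a.1 a.2) vw0.
  have lt : mu_ha A V < V v w by apply: lt_le_trans lt0 (vwmax _ vw0).
  have evw := arc _ _ vw; set T := Tha A V (V v w).
  have vT : v \in nodes T.
    rewrite inE; apply/orP; left; apply/imsetP; exists (v, w) => //.
    by rewrite -[_ \in _]/(arel T v w) arel_Tha evw lexx.
  have HS := scc_in vT; have [K KS /andP[/fintype.subsetP KH _]] :=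
    muH _ _ evw lt _ HS.
  have [y [_ [yz _ _ _]]] := girth_cycle_head KS.
  have yH := KH _ (girth_cycle_nodes KS yz).
  have vH := component_refl vT.
  apply: (detour_domination (x := v) (y := y) (mu := u v w) (T :=
    arel T) irrA uA u_le0 u_crit KS (pen K KS)) => //.
  - exact: u_le0.
  - move=> [v' w'] h; have evw' := arc _ _ h; have := vwmax _ h.
    rewrite /= !(balancing_arc VA) //.
    by rewrite rmax_leE lerD2r.
  - move=> v' w'; rewrite arel_Tha => /andP[vw' h]; apply/andP; split=> //; move: h.
    by rewrite !(balancing_arc VA) // rmax_leE lerD2r.
  - move=> v' w' c; have vw' : e v' w' := critical_sub c; rewrite arel_Tha vw' /=.
    by rewrite !(balancing_arc VA) // rmax_leE lerD2r -/(u v' w') u_crit // u_le0.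
  - by have /andP[] := mem_walk_arcs vw.
  - exact: scc_connect HS vH yH.
  - exact: scc_connect HS yH vH.
(* All arcs of the walk are at most [mu_ha]: the detour starts at its node in [Gha_nodes] and stays
   above [mu_ha]. *)
have /hasP[x xp /bigcupP[H /andP[HS /pred0Pn[k /andP[kH kc]]] xH]] := pG.
set K := component crit k; have KS : K \in sccs crit by exact: scc_in.
have kK : k \in nodes K by exact: component_refl.
have [y [_ [yz _ _ _]]] := girth_cycle_head KS.
have yK := girth_cycle_nodes KS yz.
set T := Tha A V (mu_ha A V).
have cT v w : arel crit v w -> arel T v w.
  move=> c; have vw : e v w := critical_sub c; rewrite arel_Tha vw /=.
  by rewrite (balancing_arc VA) // -/(u v w) u_crit // add0r.
have cTc v w : connect (arel crit) v w -> connect (arel T) v w.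
  by apply: connect_sub => v' w' /cT/connect1.
have [mu [mu0 muT mup]] : exists mu, [/\ mu <= 0,
    (forall v w, arel T v w -> e v w && (mu <= u v w)) &
    forall a, a \in walk_arcs i p -> u a.1 a.2 <= mu].
  case E: (mu_ha A V) => [m|]; rewrite E in mul small.
    exists (m - mcm A); split; first by rewrite subr_le0.
      move=> v w; rewrite arel_Tha => /andP[vw h]; apply/andP; split=> //; move: h.
      by rewrite E (balancing_arc VA) // rmax_leE -/(u v w); lra.
    move=> [v w] vw; have evw := arc _ _ vw; have := small _ vw; rewrite /= -leNgt.
    by rewrite (balancing_arc VA) // rmax_leE -/(u v w); lra.
  (* If [mu_ha] is -oo the walk has no arc, and any lower bound of all slacks serves. *)
  exists (- \sum_v \sum_w `|u v w|); split.
  - by rewrite oppr_le0 sumr_ge0 // => v _; rewrite sumr_ge0.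
  - move=> v w; rewrite arel_Tha => /andP[-> _] /=; rewrite lerNl.
    rewrite (bigD1 v) //= (bigD1 w) //= -addrA -[leLHS]addr0 lerD //.
      by rewrite -normrN ler_norm.
    by rewrite addr_ge0 ?sumr_ge0 // => v' _; rewrite sumr_ge0.
  - move=> [v w] vw; have evw := arc _ _ vw; have := small _ vw; rewrite /= -leNgt.
    by rewrite (balancing_arc VA).
apply: (detour_domination (x := x) (y := y) (mu := mu) (T :=
  arel T) irrA uA u_le0 u_crit KS (pen K KS)) => //.
- by apply: connect_trans (scc_connect HS xH kH) (cTc _ _ _);
    exact: scc_connect KS kK yK.
- by apply: connect_trans (cTc _ _ _) (scc_connect HS kH xH);
    exact: scc_connect KS yK kK.
Qed.

Lemma B_HA_walk_matrix : walk_matrix u delta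
  (fun x y => [&& e x y, x \notin Gha_nodes A V & y \notin Gha_nodes A V]) (mcm A) (B_HA A V).
Proof.
move=> x y; rewrite mxE uA.
by case: (x \in _); case: (y \in _); rewrite /= ?andbF ?andbT.
Qed.

(** A walk either avoids [Gha_nodes], and is a walk of [B_HA], or is dominated by the CSR term;
    [csr_le_pow] gives the converse for that term. *)
Lemma B_HA_expansion t : (forall K, K \in sccs crit ->
  (removal_penalty A K <= t)%N) ->
  A ^+ t = (mcm A)%:mp ^+ t *: (csrC A *m csrS A ^+ t *m csrR A) + B_HA A V ^+ t.
Proof.
move=> pen; apply/matrixP => i j; rewrite -/(csr A t) [RHS]mxE.
rewrite [X in X + _](_ : _ = (mcm A)%:mp ^+ t * csr A t i j); last by rewrite mxE.
apply/le_anti/andP; split; last first.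
  rewrite rmax_add_le (csr_le_pow irrA uA u_le0 u_crit) //=.
  have [->//|h] := eqVneq ((B_HA A V ^+ t) i j) 0.
  have [p [pP pl <- ->]] := walk_matrix_exp_attained B_HA_walk_matrix h.
  rewrite -pl; apply: (walk_matrix_exp_ge uA).
  by apply: sub_path pP => x y /andP[].
have [->//|h] := eqVneq ((A ^+ t) i j) 0.
have [p [pP pl ps ->]] := walk_matrix_exp_attained uA h.
have [pG|pG] := boolP (has (mem (Gha_nodes A V)) (i :: p)).
  apply: (@le_trans _ _ ((mcm A)%:mp ^+ t * csr A t i j)).
    rewrite -pl; apply: le_trans (rmax_mul_le _ (Gha_walk_domination pen pP ps pG)).
    by rewrite rmax_expE rmax_mulE rmax_leE; lra.
  by have := lexx ((mcm A)%:mp ^+ t * csr A t i j + (B_HA A V ^+ t) i j);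
    rewrite rmax_add_le => /andP[].
apply: (@le_trans _ _ ((B_HA A V ^+ t) i j)).
  rewrite -ps -pl; apply: (walk_matrix_exp_ge B_HA_walk_matrix).
  move: pG; rewrite path_walk_arcs => pG; apply/allP => -[x y] xy.
  have := pP; rewrite path_walk_arcs => /allP/(_ _ xy) /= ->.
  have /andP[xp yp] := mem_walk_arcs xy; move/hasPn: pG => pG.
  by rewrite (pG x) // (pG y) // inE yp orbT.
by have := lexx ((mcm A)%:mp ^+ t * csr A t i j + (B_HA A V ^+ t) i j);
  rewrite rmax_add_le => /andP[].
Qed.

End HartmannArguelles.

(** * The bounds, for a general matrix and for the Hartmann-Arguelles scheme *)

Theorem theorem5p3 (R : realType) (d : nat) (A : 'M[rmax R]_d)
    (irrA : mp_irreducible A) :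
  let gamma := scc_cyclicity (graph A) in
  let g := max_girth_critical A in
  let bounds (T1 : nat) :=
    (T1 <= gamma * Wi (d %/ gamma) + d %% gamma)%N /\
    T1%:Z <= g%:Z * ((d %/ gamma)%N%:Z - 2) + d%:Z in
  (forall B : 'M[rmax R]_d, subordinate B A ->
   forall T1 : nat, is_T1 A B T1 ->
   (forall G : digraph d, representing A G -> (T1 <= csr_bound A G)%N) ->
   bounds T1)
  /\
  (forall V : 'M[rmax R]_d, max_balancing A V ->
   exists2 T1 : nat, is_T1 A (B_HA A V) T1 & bounds T1).
Proof.
move=> gamma g bounds; split=> [B _ T1 _ T1G|V [[delta VA] balV]].
  apply: penalty_bounds => //.
  by rewrite -csr_bound_girth_subgraph; exact/T1G/girth_subgraph_representing.
have expansion t : (\max_(K in sccs (critical_graph A)) removal_penalty A K <= t)%N ->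
    A ^+ t = (mcm A)%:mp ^+ t *: (csrC A *m csrS A ^+ t *m csrR A) + B_HA A V ^+ t.
  by move=> /bigmax_leqP h; apply: (B_HA_expansion irrA VA balV).
(* The expansion holds from the largest penalty on, so the least such time exists and is at most
   that penalty. *)
eexists; first by apply: leastP; eexists => t; exact: expansion.
by apply: penalty_bounds => //; apply: least_le => t; exact: expansion.
Qed.
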